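(* Let $\vec{\mathcal H}$ be a finite sequence of conjugacy classes of finitely generated subgroups of $F(\mathcal B)$. The following are equivalent: (1) there is $\alpha\in\mathrm{Aut}(F(\mathcal B))$ such that $\Sigma(\alpha\vec{\mathcal H})$ can be visibly blown up; (2) for some Gersten representative $\vec{\mathcal H}'$ of $\vec{\mathcal H}$, $\Sigma(\vec{\mathcal H}')$ can be visibly blown up; (3) for every Gersten representative $\vec{\mathcal H}'$ of $\vec{\mathcal H}$, $\Sigma(\vec{\mathcal H}')$ can be visibly blown up.
   Context: $F(\mathcal B)$ is the free group on a finite set $\mathcal B$, identified with $\pi_1$ of the rose $R_{\mathcal B}$. For a conjugacy class $[[H]]$ of a finitely generated subgroup, $\Sigma([[H]])$ is the core of the covering graph of $R_{\mathcal B}$ corresponding to $H$, a finite graph with oriented edges labeled in $\mathcal B^{\pm1}$ (empty if $H=1$); for a sequence, $\Sigma(\vec{\mathcal H})$ is the sequence of these graphs, and automorphisms act componentwise. The complexity of $\vec{\mathcal H}$ is the total number of edges of $\Sigma(\vec{\mathcal H})$; $\vec{\mathcal H}'$ is a Gersten representative of $\vec{\mathcal H}$ if $\vec{\mathcal H}'=\beta\vec{\mathcal H}$ for some automorphism $\beta$ and has minimal complexity among all $\alpha\vec{\mathcal H}$, $\alpha\in\mathrm{Aut}(F(\mathcal B))$. A sequence $(\Sigma_i)_{i\in I}$ of labeled graphs can be visibly blown up if there is a partition $\mathcal B=\mathcal B'\sqcup\mathcal B''$ into two nonempty sets such that for each $i$, the labels of $\Sigma_i$ all lie in $\mathcal B'^{\pm1}$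 or all lie in $\mathcal B''^{\pm1}$. *)

(* Defs.v *)
From mathcomp Require Import all_boot.
Set Implicit Arguments. Unset Strict Implicit. Unset Printing Implicit Defensive.

Section FreeGroup.
Variable B : finType.

(* A letter (b, true) stands for b, (b, false) for b^-1. *)
Definition letter := (B * bool)%type.
Definition word := seq letter.

Definition inv_letter (a : letter) : letter := (a.1, ~~ a.2).
Definition inverse_pair (a c : letter) : bool := (c == inv_letter a).

Fixpoint red (w : word) : word :=
  match w with
  | [::] => [::]
  | a :: w' =>
      match red w' with
      | c :: r' => if inverse_pair a c then r' else a :: c :: r'
      | [::] => [:: a]
      end
  end.

Definition winv (w : word) : word := rev (map inv_letter w).

(* elements of F(B) are words modulo free reduction *)
Definition eqF (u v : word) : Prop := red u = red v.

Fixpoint reducedb (w : word) : bool :=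
  match w with
  | a :: ((c :: _) as w') => ~~ inverse_pair a c && reducedb w'
  | _ => true
  end.

Definition cyc_reduced (w : word) : bool :=
  reducedb w &&
  (match w with
   | [::] => true
   | a :: _ => ~~ inverse_pair (last a w) a
   end).

Definition is_aut (phi : word -> word) : Prop :=
  (forall u v, eqF u v -> eqF (phi u) (phi v)) /\
  (forall u v, eqF (phi (u ++ v)) (phi u ++ phi v)) /\
  (forall u v, eqF (phi u) (phi v) -> eqF u v) /\
  (forall v, exists u, eqF (phi u) v).

Inductive gen_by (gens : seq word) : word -> Prop :=
  | gen_one : gen_by gens [::]
  | gen_gen g w : g \in gens -> gen_by gens w -> gen_by gens (g ++ w)
  | gen_inv g w : g \in gens -> gen_by gens w -> gen_by gens (winv g ++ w).

Definition in_sub (gens : seq word) (w : word) : Prop :=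
  exists w', gen_by gens w' /\ eqF w' w.

Definition same_coset (gens : seq word) (x y : word) : Prop :=
  in_sub gens (x ++ winv y).

(* The Schreier (covering) graph of H = <gens>: vertices Hx, edges Hx --b--> Hxb,
   an edge is represented by a pair (x, b).  It lies in the core iff it is
   traversed by an immersed cycle, i.e. a closed reduced path reading a
   nonempty cyclically reduced word w based at a vertex Hx0 (x0 w x0^-1 in H). *)
Definition core_edge (gens : seq word) (x : word) (b : B) : Prop :=
  exists x0 w, w != [::] /\ cyc_reduced w /\ in_sub gens (x0 ++ w ++ winv x0) /\
    exists u v,
      (w = u ++ (b, true) :: v /\ same_coset gens x (x0 ++ u)) \/
      (w = u ++ (b, false) :: v /\ same_coset gens x (x0 ++ u ++ [:: (b, false)])).

Definition same_edge (gens : seq word) (e f : word * B) : Prop :=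
  e.2 = f.2 /\ same_coset gens e.1 f.1.

Fixpoint pairwiseP (T : eqType) (R : T -> T -> Prop) (s : seq T) : Prop :=
  match s with
  | [::] => True
  | a :: s' => (forall c, c \in s' -> R a c) /\ pairwiseP R s'
  end.

Definition core_nedges (gens : seq word) (n : nat) : Prop :=
  exists s : seq (word * B),
    size s = n /\
    (forall e, e \in s -> core_edge gens e.1 e.2) /\
    pairwiseP (fun e f => ~ same_edge gens e f) s /\
    (forall x b, core_edge gens x b -> exists e, e \in s /\ same_edge gens (x, b) e).

Definition core_label (gens : seq word) (b : B) : Prop :=
  exists x, core_edge gens x b.

(* A finite sequence of conjugacy classes of f.g. subgroups is represented by a
   list of finite generating lists of representatives. *)
Definition subgroup_seq := seq (seq word).

Definition complexity (Hs : subgroup_seq) (n : nat) : Prop :=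
  exists ns : seq nat, size ns = size Hs /\
    (forall i, i < size Hs -> core_nedges (nth [::] Hs i) (nth 0 ns i)) /\
    sumn ns = n.

Definition act (alpha : word -> word) (Hs : subgroup_seq) : subgroup_seq :=
  map (map alpha) Hs.

Definition same_class (H1 H2 : seq word) : Prop :=
  exists g, forall w, in_sub H1 w <-> in_sub H2 (g ++ w ++ winv g).

Definition same_class_seq (Hs1 Hs2 : subgroup_seq) : Prop :=
  size Hs1 = size Hs2 /\
  forall i, i < size Hs1 -> same_class (nth [::] Hs1 i) (nth [::] Hs2 i).

Definition gersten_rep (Hs' Hs : subgroup_seq) : Prop :=
  (exists beta, is_aut beta /\ same_class_seq Hs' (act beta Hs)) /\
  exists n, complexity Hs' n /\
    forall alpha m, is_aut alpha -> complexity (act alpha Hs) m -> n <= m.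

Definition visibly_blown_up (Hs : subgroup_seq) : Prop :=
  exists P : pred B, (exists b, P b) /\ (exists b, ~~ P b) /\
    forall i, i < size Hs ->
      (forall b, core_label (nth [::] Hs i) b -> P b) \/
      (forall b, core_label (nth [::] Hs i) b -> ~~ P b).

End FreeGroup.

(* Main.v *)
(* Gersten's theorem on minimal representatives is not needed: Whitehead's
   cut-vertex argument applies directly to subgroups.

   The Whitehead graph of the sequence has the letters B^{+-1} as vertices, two
   letters being adjacent when they are directions at a common vertex of some
   core graph.  A Whitehead automorphism given by a set Z of letters and a letter
   b0 separated from its inverse by Z blows up the vertices whose directions lie
   on both sides of Z and collapses the b0-edges.  Hence at minimal complexity a
   union of components is closed under inversion of the letters that occur, and
   there is no cut vertex.  If moreover no visible blow-up exists, every letter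
   occurs and the graph stays connected after deleting any letter.

   Suppose now that the image under alpha is visibly blown up.  The corresponding
   free splitting colours the vertices g of the Cayley tree by the type of the
   first letter of alpha(g).  The colour changes along finitely many edges, and
   far away it agrees on all rays from a given vertex whose directions lie in the
   link of one core vertex, because each subgroup is elliptic in the splitting.
   By descending induction on the length of g, connectedness of the graph minus a
   letter makes the colour at infinity constant beyond g; at g = 1 it is constant
   everywhere, although both colours occur arbitrarily far out. *)
Require Import Defs.
From HB Require Import structures.
From mathcomp Require Import all_boot monoid.
From Stdlib Require Import ClassicalEpsilon.
Set Implicit Arguments. Unset Strict Implicit. Unset Printing Implicit Defensive.
Local Open Scope group_scope.

(** * The free group on reduced words *)

Ltac gnorm := rewrite ?(mulg1, mul1g, invg1, mulgA, invgM, invgK, mulgK,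
  mulgVK, mulgV, mulVg) //.

Section Words.
Variable B : finType.
Implicit Types (a c x : letter B) (u v w p q : word B).

Definition no_backtrack a c := ~~ inverse_pair a c.

Lemma inv_letterK : involutive (@inv_letter B).
Proof. by case=> b s; rewrite /inv_letter /= negbK. Qed.

Lemma inv_letter_inj : injective (@inv_letter B).
Proof. exact: inv_inj inv_letterK. Qed.

Lemma inv_letter_neq a : inv_letter a != a.
Proof. by case: a => b []; rewrite /inv_letter /= xpair_eqE andbF. Qed.

Lemma inverse_pairC a c : inverse_pair a c = inverse_pair c a.
Proof. by rewrite /inverse_pair -(inj_eq inv_letter_inj) inv_letterK eq_sym. Qed.

Lemma inverse_pairV a c :
  inverse_pair (inv_letter a) (inv_letter c) = inverse_pair a c.
Proof. by rewrite /inverse_pair (inj_eq inv_letter_inj). Qed.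

Lemma reducedbE w : reducedb w = sorted no_backtrack w.
Proof. by elim: w => //= a [|c w] //= ->. Qed.

Lemma cyc_reducedE w : cyc_reduced w = cycle no_backtrack w.
Proof.
case: w => // a w; rewrite /cyc_reduced reducedbE /= rcons_path.
by rewrite /no_backtrack.
Qed.

Lemma cyc_reducedW w : cyc_reduced w -> reducedb w.
Proof. by case/andP. Qed.

Lemma red_reduced w : reducedb w -> red w = w.
Proof.
by elim: w => //= a [|c w] //= IH /andP[ac /IH ->]; rewrite (negbTE ac).
Qed.

Lemma reducedb_red w : reducedb (red w).
Proof.
elim: w => //= a w; case: (red w) => // c r; case: ifP => //= [_|-> //].
by case: r => // d r /andP[].
Qed.

Lemma redK w : red (red w) = red w.
Proof. exact/red_reduced/reducedb_red. Qed.

Lemma red_cancel a w : red (a :: inv_letter a :: w) = red w.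
Proof.
rewrite /=; have := reducedb_red w; case: (red w) => [|c r] /= R.
  by rewrite /inverse_pair eqxx.
rewrite {1}/inverse_pair inv_letterK; case: eqP => [<-|_].
  by case: r R => // d r /andP[/negbTE ->].
by rewrite /inverse_pair eqxx.
Qed.

Lemma red_catr u v : red (u ++ red v) = red (u ++ v).
Proof. by elim: u => [|a u IH] /=; rewrite ?redK ?IH. Qed.

Lemma red_catl u v : red (red u ++ v) = red (u ++ v).
Proof.
elim: u => //= a u <-; case: (red u) => [|c r] //=.
case: ifP => //= /eqP ->; rewrite -/(red (r ++ v)).
exact/esym/(@red_cancel a (r ++ v)).
Qed.

Lemma red_cons_reduced a r : reducedb r ->
  red (a :: r) = a :: r \/ r = inv_letter a :: red (a :: r).
Proof.
move=> R; rewrite /= (red_reduced R); case: r R => [|c r] R; first by left.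
by case: ifP => [/eqP -> |]; [right|left].
Qed.

Lemma size_red w : size (red w) <= size w.
Proof.
elim: w => //= a w; case: (red w) => //= c r; case: ifP => //= _ H.
by apply: leq_trans (leqW H); rewrite leqW.
Qed.

Lemma winvK : involutive (@winv B).
Proof.
move=> w; rewrite /winv map_rev revK -map_comp -[RHS]map_id.
by apply: eq_map => a /=; rewrite inv_letterK.
Qed.

Lemma winv_cat u v : winv (u ++ v) = winv v ++ winv u.
Proof. by rewrite /winv map_cat rev_cat. Qed.

Lemma winv_cons a u : winv (a :: u) = winv u ++ [:: inv_letter a].
Proof. by rewrite /winv /= rev_cons cats1. Qed.

Lemma size_winv w : size (winv w) = size w.
Proof. by rewrite /winv size_rev size_map. Qed.

Lemma red_mulV u : red (u ++ winv u) = [::].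
Proof.
elim: u => //= a u IH; rewrite winv_cons catA -red_catl IH /=.
by rewrite /inverse_pair eqxx.
Qed.

Lemma red_mulVl u : red (winv u ++ u) = [::].
Proof. by rewrite -{2}[u]winvK red_mulV. Qed.

Lemma reducedb_winv w : reducedb (winv w) = reducedb w.
Proof.
rewrite !reducedbE /winv rev_sorted sorted_map; apply: eq_sorted => a c /=.
by rewrite /no_backtrack inverse_pairV inverse_pairC.
Qed.

(** Normal forms as elements: Leibniz equality replaces [eqF], and the group library applies. *)
Definition free_group := {w : seq (B * bool) | @reducedb B w}.
HB.instance Definition _ := Choice.on free_group.

Definition cls (w : word B) : free_group := exist _ (red w) (reducedb_red w).

Lemma val_cls w : val (cls w) = red w. Proof. by []. Qed.

Lemma clsK (g : free_group) : cls (val g) = g.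
Proof. by apply: val_inj; rewrite /= red_reduced ?(valP g). Qed.

Lemma eqF_cls u v : eqF u v <-> cls u = cls v.
Proof. by split=> [H | [] //]; apply: val_inj. Qed.

Lemma cls_red w : cls (red w) = cls w.
Proof. by apply: val_inj; rewrite /= redK. Qed.

(* Locked, so that unification does not unfold the group operations. *)
Fact free_group_key : unit. Proof. by []. Qed.
Definition mulF : free_group -> free_group -> free_group :=
  locked_with free_group_key (fun g h => cls (val g ++ val h)).
Definition invF : free_group -> free_group :=
  locked_with free_group_key (fun g => cls (winv (val g))).

Lemma val_mulF g h : val (mulF g h) = red (val g ++ val h).
Proof. by rewrite /mulF unlock. Qed.

Lemma val_invF g : val (invF g) = red (winv (val g)).
Proof. by rewrite /invF unlock. Qed.

Fact mulF_assoc : associative mulF.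
Proof.
by move=> x y z; apply: val_inj; rewrite !val_mulF red_catr red_catl catA.
Qed.
Fact mulF_1 : left_id (cls [::]) mulF.
Proof. by move=> x; apply: val_inj; rewrite val_mulF red_reduced ?(valP x). Qed.
Fact mulF_1r : right_id (cls [::]) mulF.
Proof.
by move=> x; apply: val_inj; rewrite val_mulF cats0 red_reduced ?(valP x).
Qed.
Fact mulF_V : left_inverse (cls [::]) invF mulF.
Proof. by move=> x; apply: val_inj; rewrite val_mulF val_invF red_catl red_mulVl. Qed.
Fact mulF_Vr : right_inverse (cls [::]) invF mulF.
Proof. by move=> x; apply: val_inj; rewrite val_mulF val_invF red_catr red_mulV. Qed.

HB.instance Definition _ :=
  isGroup.Build free_group mulF_assoc mulF_1 mulF_1r mulF_V mulF_Vr.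

Lemma cls_nil : cls [::] = 1. Proof. by []. Qed.

Lemma cls_cat u v : cls (u ++ v) = cls u * cls v.
Proof. by apply: val_inj; rewrite val_mulF red_catl red_catr. Qed.

Lemma cls_winv u : cls (winv u) = (cls u)^-1.
Proof.
apply: (@mulgI _ (cls u)); rewrite mulgV -cls_cat.
by apply: val_inj; rewrite /= red_mulV.
Qed.

Lemma cls_cons a u : cls (a :: u) = cls [:: a] * cls u.
Proof. by rewrite -cls_cat. Qed.

Lemma cls_inv_letter a : cls [:: inv_letter a] = (cls [:: a])^-1.
Proof. by rewrite -cls_winv. Qed.

Lemma val_mul (g h : free_group) : val (g * h) = red (val g ++ val h).
Proof. exact: val_mulF. Qed.

End Words.

(** * Paths in the Cayley tree *)

Section Paths.
Variable B : finType.
Implicit Types (a c x l : letter B) (u v w p q : word B).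
Notation F := (free_group B).
Implicit Types (g h y z : F) (e : F * B).

(** An edge of the Cayley tree is named by its origin in the positive orientation, so crossing it
    either way yields the same pair. *)
Definition edge_at y x : F * B := (if x.2 then y else y * cls [:: x], x.1).

Fixpoint edges y w : seq (F * B) :=
  if w is x :: w' then edge_at y x :: edges (y * cls [:: x]) w' else [::].

Lemma edges_cat y u v : edges y (u ++ v) = edges y u ++ edges (y * cls u) v.
Proof.
elim: u y => [|x u IH] y /=; first by rewrite cls_nil mulg1.
by rewrite IH (cls_cons x u) mulgA.
Qed.

Lemma edges_translate g y w :
  edges (g * y) w = [seq (g * e.1, e.2) | e <- edges y w].
Proof.
elim: w y => //= x w IH y; rewrite -mulgA IH; congr (_ :: _).
by rewrite /edge_at /=; case: ifP; rewrite ?mulgA.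
Qed.

Lemma edges_labels y w : [seq e.2 | e <- edges y w] = [seq x.1 | x <- w].
Proof. by elim: w y => //= x w IH y; rewrite IH. Qed.

(** Cancelling an inverse pair deletes a backtrack from the path, which can only lose edges. *)
Lemma edges_red y w : {subset edges y (red w) <= edges y w}.
Proof.
elim: w y => // a w IH y; rewrite -(red_catr [:: a]).
case: (red_cons_reduced a (reducedb_red w)) => [->|E] e /=.
  by rewrite !inE => /predU1P[->|/IH ->]; rewrite ?eqxx ?orbT.
move=> H; rewrite inE IH ?orbT // E /= inE cls_inv_letter.
by rewrite -mulgA mulgV mulg1 H orbT.
Qed.

Lemma red_winv w : red (winv w) = winv (red w).
Proof.
rewrite -[RHS]red_reduced ?reducedb_winv ?reducedb_red //.
by rewrite -!val_cls; congr val; rewrite !cls_winv cls_red.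
Qed.

(** Each letter of [p] cancels at most one letter of [red q], so beyond its first [size p] letters
    the result is a suffix of [red q]. *)
Lemma red_cat_suffix p q r1 r2 :
  red (p ++ q) = r1 ++ r2 -> size p <= size r1 -> exists s, red q = s ++ r2.
Proof.
elim: p r1 => [|a p IH] r1 /=; first by exists r1.
rewrite -/(red (a :: (p ++ q))) -(red_catr [:: a]).
case: (red_cons_reduced a (reducedb_red (p ++ q))) => [->|E].
  by case: r1 => //= c r1 [_ E] sz; apply: (IH r1).
(* The letter cancelled by [a] joins [r1], which preserves the size bound. *)
move=> Er sz; apply: (IH (inv_letter a :: r1)); last by rewrite /= ltnW // ltnW.
by rewrite E Er.
Qed.

Lemma red_cat_prefix p q r1 r2 :
  red (q ++ p) = r2 ++ r1 -> size p <= size r1 -> exists s, red q = r2 ++ s.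
Proof.
move=> E sz; have [s Es] : exists s, red (winv q) = s ++ winv r2.
  apply: (@red_cat_suffix (winv p) _ (winv r1)); last by rewrite !size_winv.
  by rewrite -!winv_cat red_winv E.
exists (winv s); apply: (can_inj (@winvK B)).
by rewrite -red_winv Es winv_cat winvK.
Qed.

(* Free reduction of [p ++ q ++ p'] can only disturb the outer [size p] and
   [size p'] letters, so what is read in between already occurs along [q]. *)
Lemma edges_middle y p q p' r1 r2 r3 :
  red (p ++ q ++ p') = r1 ++ r2 ++ r3 ->
  size p <= size r1 -> size p' <= size r3 ->
  {subset edges (y * cls r1) r2 <= edges (y * cls p) q}.
Proof.
move=> E s1 s3; have [s Es] := red_cat_suffix E s1.
have [t Et] : exists t, red q = (s ++ r2) ++ t.
  by apply: red_cat_prefix s3; rewrite Es catA.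
have -> : cls r1 = cls p * cls s.
  apply: (@mulIg _ (cls (r2 ++ r3))); rewrite -mulgA -!cls_cat -E cls_red.
  by rewrite cls_cat -[cls (q ++ p')]cls_red Es !cls_cat.
move=> e He; apply: edges_red; rewrite Et !edges_cat !mem_cat.
by rewrite mulgA in He; rewrite He orbT.
Qed.

Definition wpow w n : word B := flatten (nseq n w).

Lemma wpowS w n : wpow w n.+1 = w ++ wpow w n. Proof. by []. Qed.

Lemma wpowD w m n : wpow w (m + n) = wpow w m ++ wpow w n.
Proof. by rewrite /wpow nseqD flatten_cat. Qed.

Lemma cls_wpow w n : cls (wpow w n) = cls w ^+ n.
Proof. by elim: n => // n IH; rewrite expgS -IH -cls_cat. Qed.

Lemma size_wpow w n : w != [::] -> n <= size (wpow w n).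
Proof.
move=> w0; elim: n => // n IH; rewrite wpowS size_cat.
by rewrite -add1n leq_add // lt0n size_eq0.
Qed.

Lemma cyc_reduced_wpow w n : cyc_reduced w -> cyc_reduced (wpow w n).
Proof.
rewrite !cyc_reducedE; case: w => [|a t]; first by elim: n.
case: n => // n; rewrite wpowS /= => H.
elim: n => [|n IH]; first by rewrite /wpow /= cats0.
rewrite wpowS -cats1 -catA cat_path.
by move: H; rewrite -cats1 cat_path /= => /andP[-> /andP[-> _]]; rewrite cats1.
Qed.

Lemma cyc_reduced_rot u v : cyc_reduced (u ++ v) -> cyc_reduced (v ++ u).
Proof. by rewrite !cyc_reducedE -(rot_cycle (size u)) rot_size_cat. Qed.

Lemma cyc_reduced_winv w : cyc_reduced w -> cyc_reduced (winv w).
Proof.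
rewrite !cyc_reducedE /winv rev_cycle; case: w => //= a w.
rewrite -map_rcons path_map; apply: sub_path => x c /=.
by rewrite /no_backtrack inverse_pairV inverse_pairC.
Qed.

Lemma cyc_reduced_decomposition w : reducedb w ->
  exists p u, w = p ++ u ++ winv p /\ cyc_reduced u.
Proof.
elim: {w}(size w) {-2}w (leqnn (size w)) => [|n IH] w.
  by rewrite leqn0 size_eq0 => /eqP-> _; exists [::], [::].
have [C _ _|] := boolP (cyc_reduced w).
  by exists [::], w; rewrite /winv cats0.
case: w => // a w; rewrite /cyc_reduced; case/lastP: w => [|w c].
  by rewrite /= /inverse_pair eq_sym (negbTE (inv_letter_neq a)).
rewrite -rcons_cons last_rcons negb_and negbK => /orP[/negbTE-> //|].
rewrite inverse_pairC => /eqP -> sz R.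
have Rw : reducedb w.
  move: R; rewrite reducedbE /= rcons_path => /andP[/path_sorted].
  by rewrite reducedbE.
case: (IH w) => //; first by rewrite /= size_rcons ltnS in sz; rewrite ltnW.
move=> p [u [-> Cu]]; exists (a :: p), u; split=> //.
by rewrite winv_cons rcons_cons -cats1 -!catA.
Qed.

(* The reduced word [w ^ n] equals [p ++ q ++ p^-1] up to reduction, and a
   middle copy of [w] is out of reach of the cancellation at both ends. *)
Lemma edges_axis w p q y n : cyc_reduced w -> (size p).*2 < n ->
  cls w ^+ n = cls p * cls q * (cls p)^-1 ->
  {subset edges (y * cls w ^+ size p) w <= edges (y * cls p) q}.
Proof.
have [-> //|w0] := eqVneq w [::]; move=> C ltn E.
have Cn := cyc_reducedW (cyc_reduced_wpow n C).
rewrite -cls_wpow; apply: (@edges_middle y p q (winv p)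
  (wpow w (size p)) w (wpow w (n - (size p).+1))).
- have -> : red (p ++ q ++ winv p) = wpow w n.
    rewrite -(red_reduced Cn) -!val_cls; congr val.
    by rewrite cls_wpow E !cls_cat cls_winv mulgA.
  rewrite -[X in wpow w X](@subnKC (size p).+1); last first.
    by apply: leq_ltn_trans ltn; rewrite -addnn leq_addr.
  by rewrite -addn1 -addnA !wpowD /= addn1 {2}/wpow /= cats0.
- exact: size_wpow.
- rewrite size_winv; apply: leq_trans (size_wpow _ w0).
  have lt2 : (size p).+1 + size p <= n by rewrite addSn addnn.
  by rewrite leq_subRL // (leq_trans _ lt2) ?leq_addr.
Qed.

Definition wover (P : pred B) w := all (fun x => P x.1) w.

Lemma wover_red P w : wover P w -> wover P (red w).
Proof.
rewrite /wover => Pw; rewrite -(all_map fst P) -(edges_labels 1) all_map.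
apply/allP => e /edges_red He /=; move: Pw.
rewrite -(all_map fst P) -(edges_labels 1) all_map => /allP; exact.
Qed.

Lemma wover_winv P w : wover P (winv w) = wover P w.
Proof. by rewrite /wover /winv all_rev all_map. Qed.

Lemma wover_cat P u v : wover P (u ++ v) = wover P u && wover P v.
Proof. exact: all_cat. Qed.

Lemma wover_wpow P w n : wover P w -> wover P (wpow w n).
Proof. by move=> Pw; elim: n => // n IH; rewrite wpowS wover_cat Pw. Qed.

Lemma expg_conj z h n : (z * h * z^-1) ^+ n = z * h ^+ n * z^-1.
Proof.
elim: n => [|n IH]; first by rewrite !expg0 mulg1 mulgV.
by rewrite !expgS IH; gnorm.
Qed.

(** Powers of [w] and [q] are conjugate by the same [z]; once the exponent exceeds twice the length
    of [z], a copy of [w] survives along the power of [q] and uses only its labels. *)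
Lemma wover_cyc_conj P w z q :
  cyc_reduced w -> cls w = z * cls q * z^-1 -> wover P q -> wover P w.
Proof.
move=> C E; rewrite /wover -!(all_map fst P).
rewrite -(edges_labels (1 * cls w ^+ size (val z)) w).
set n := (size (val z)).*2.+1 => Pq.
have Pn : wover P (wpow q n) by apply: wover_wpow; rewrite /wover -(all_map fst P).
rewrite /wover -(all_map fst P) -(edges_labels (1 * cls (val z))) in Pn.
rewrite all_map; apply/allP => e; move: Pn; rewrite all_map => /allP Pn /=.
move/(edges_axis (p := val z) (q := wpow q n) C (ltnSn _)) => H.
by apply/Pn/H; rewrite clsK cls_wpow E expg_conj.
Qed.

End Paths.

(** * Cores of subgroups *)

Section Subgroups.
Variable B : finType.
Implicit Types (a c x l : letter B) (u v w p q : word B).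
Notation F := (free_group B).
Implicit Types (g h k y z : F) (K : F -> Prop) (gens : seq (word B)).

Definition is_subgroup K :=
  [/\ K 1, forall g h, K g -> K h -> K (g * h) & forall g, K g -> K g^-1].

Definition gsub gens g := in_sub gens (val g).

Lemma in_subE gens w : in_sub gens w <-> gsub gens (cls w).
Proof. by rewrite /gsub /in_sub /eqF val_cls redK. Qed.

Lemma gen_by_cat gens u v :
  gen_by gens u -> gen_by gens v -> gen_by gens (u ++ v).
Proof.
by move=> Hu Hv; elim: Hu => // g w gin _ IH; rewrite -catA; constructor.
Qed.

Lemma gen_by_winv gens u : gen_by gens u -> gen_by gens (winv u).
Proof.
elim=> [|g w gin _ IH|g w gin _ IH]; first exact: gen_one.
  rewrite winv_cat; apply: gen_by_cat => //; rewrite -[winv g]cats0.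
  exact/gen_inv/gen_one.
rewrite winv_cat winvK; apply: gen_by_cat => //; rewrite -[g]cats0.
exact/gen_gen/gen_one.
Qed.

Lemma gsubP gens g : gsub gens g <-> exists2 w, gen_by gens w & g = cls w.
Proof.
rewrite -{1}[g]clsK -in_subE; split=> [[w [Hw /eqF_cls E]]|[w Hw ->]].
  by exists w; rewrite // E clsK.
by exists w; split=> //; rewrite /eqF val_cls redK.
Qed.

Lemma gsub_subgroup gens : is_subgroup (gsub gens).
Proof.
split=> [|g h /gsubP[u Hu ->] /gsubP[v Hv ->]|g /gsubP[u Hu ->]].
- by apply/gsubP; exists [::]; first exact: gen_one.
- by apply/gsubP; exists (u ++ v); [exact: gen_by_cat | rewrite cls_cat].
- by apply/gsubP; exists (winv u); [exact: gen_by_winv | rewrite cls_winv].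
Qed.

Lemma same_cosetE gens u v :
  same_coset gens u v <-> gsub gens (cls u * (cls v)^-1).
Proof. by rewrite /same_coset in_subE cls_cat cls_winv. Qed.

(* The letter [l] is a direction of the core of [K \ tree] at the vertex [K g]. *)
Definition core_dir K g l :=
  exists w, cyc_reduced (l :: w) /\ K (g * cls (l :: w) * g^-1).

Lemma core_dir_rot K y u l v : cyc_reduced (u ++ l :: v) ->
  K (y * cls (u ++ l :: v) * y^-1) -> core_dir K (y * cls u) l.
Proof.
move=> C Ky; exists (v ++ u); split; first exact: (cyc_reduced_rot C).
move: Ky; rewrite -cat_cons !cls_cat; congr K; gnorm.
Qed.

Lemma core_dir_inv_last K y w l : is_subgroup K -> cyc_reduced (rcons w l) ->
  K (y * cls (rcons w l) * y^-1) -> core_dir K y (inv_letter l).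
Proof.
move=> [_ _ KV] C /KV Ky; exists (winv w).
have E : inv_letter l :: winv w = winv (rcons w l).
  by rewrite -cats1 winv_cat.
rewrite E cls_winv; split; first exact: cyc_reduced_winv.
by move: Ky; congr K; gnorm.
Qed.

Lemma core_dir_flip K g l : is_subgroup K ->
  core_dir K g l -> core_dir K (g * cls [:: l]) (inv_letter l).
Proof.
move=> sK [w [C Kg]]; apply: (@core_dir_inv_last _ _ w) => //.
  by rewrite -cats1; apply: (cyc_reduced_rot (u := [:: l])).
by move: Kg; rewrite -cats1 cls_cat cls_cons; congr K; gnorm.
Qed.

Lemma core_dir_coset K g h l : is_subgroup K ->
  K (h * g^-1) -> core_dir K g l -> core_dir K h l.
Proof.
move=> [_ KM KV] Kk [w [C Kg]]; exists w; split=> //.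
by move: (KM _ _ (KM _ _ Kk Kg) (KV _ Kk)); congr K; gnorm.
Qed.

Lemma core_edgeE gens w b :
  core_edge gens w b <-> core_dir (gsub gens) (cls w) (b, true).
Proof.
have sK := gsub_subgroup gens; split.
  case=> [x0 [c [_ [C [Hc [u [v H]]]]]]].
  have Kc : gsub gens (cls x0 * cls c * (cls x0)^-1).
    by move/in_subE: Hc; rewrite !cls_cat cls_winv mulgA.
  case: H => [[E]|[E]] /same_cosetE Hw; subst c.
    rewrite cls_cat in Hw; exact: core_dir_coset Hw (core_dir_rot C Kc).
  (* A negative letter crosses the edge backwards, so the origin is the vertex reached after it. *)
  rewrite !cls_cat mulgA in Hw; apply: core_dir_coset Hw _ => //.
  exact: core_dir_flip (core_dir_rot C Kc).
case=> [c [C Kc]]; exists w, ((b, true) :: c); split=> //; split=> //; split.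
  by apply/in_subE; rewrite !cls_cat cls_winv mulgA.
exists [::], c; left; split=> //; apply/same_cosetE.
by rewrite cats0 mulgV; case: sK.
Qed.

(** A finite list meeting every orbit of core edges: a product of generators traces translates of
    their loops, each starting at an element of the subgroup. *)
Definition generator_edges gens : seq (F * B) :=
  flatten [seq edges 1 u ++ edges 1 (winv u) | u <- gens].

Lemma gen_by_edges gens w : gen_by gens w -> forall y, gsub gens y ->
  forall e, e \in edges y w ->
  exists2 f, f \in generator_edges gens & e.2 = f.2 /\ gsub gens (e.1 * f.1^-1).
Proof.
have [_ KM _] := gsub_subgroup gens.
have step u v y : gen_by gens u -> {subset edges 1 u <= generator_edges gens} ->
    (forall y, gsub gens y -> forall e, e \in edges y v ->
      exists2 f, f \in generator_edges gens
               & e.2 = f.2 /\ gsub gens (e.1 * f.1^-1)) ->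
    gsub gens y -> forall e, e \in edges y (u ++ v) ->
    exists2 f, f \in generator_edges gens
             & e.2 = f.2 /\ gsub gens (e.1 * f.1^-1).
  move=> Hg sub IH Ky e; rewrite edges_cat mem_cat => /orP[|]; last first.
    by apply: IH; apply: KM => //; apply/gsubP; exists u.
  rewrite -[y]mulg1 edges_translate => /mapP[f /sub fin ->].
  by exists f => //=; rewrite mulgK.
elim=> {w} // g w gin _ IH y Ky e; apply: step => // {e}.
- by rewrite -[g]cats0; apply/gen_gen/gen_one.
- move=> e He; apply/flattenP; exists (edges 1 g ++ edges 1 (winv g)).
    by apply/mapP; exists g.
  by rewrite mem_cat He.
- by rewrite -[winv g]cats0; apply/gen_inv/gen_one.
- move=> e He; apply/flattenP; exists (edges 1 g ++ edges 1 (winv g)).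
    by apply/mapP; exists g.
  by rewrite mem_cat He orbT.
Qed.

(** A power of the loop through the edge is, conjugated by [g], a product [q] of generators, and the
    axis of the loop runs along the path of [q]. *)
Lemma core_dir_generator_edges gens g b : core_dir (gsub gens) g (b, true) ->
  exists2 f, f \in generator_edges gens & b = f.2 /\ gsub gens (g * f.1^-1).
Proof.
have [K1 KM KV] := gsub_subgroup gens.
have KX h n : gsub gens h -> gsub gens (h ^+ n).
  by move=> Kh; elim: n => // n IH; rewrite expgS; apply: KM.
case=> [w [C Kg]]; set n := (size (val g^-1)).*2.+1.
have /gsubP[q Hq E] := KX _ n Kg.
have Ew : cls ((b, true) :: w) ^+ n = cls (val g^-1) * cls q * (cls (val g^-1))^-1.
  by rewrite -E clsK expg_conj; gnorm.
have /= := edges_axis (y := g) C (ltnSn _) Ew.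
set m := size (val g^-1); rewrite clsK mulgV.
set e := edge_at _ _ => /(_ e); rewrite inE eqxx => /(_ isT) He.
have [f fin [/= fb fK]] := gen_by_edges Hq K1 He.
exists f => //; split=> //.
(* The edge was found [m] periods further along the axis; an element of the subgroup brings it
   back. *)
have := KM _ _ (KV _ (KX _ m Kg)) fK; rewrite expg_conj.
by congr (gsub gens); rewrite /edge_at /=; gnorm.
Qed.

Lemma pairwise_representatives (T : eqType) (R : T -> T -> Prop)
    (Q : T -> Prop) (E : seq T) : (forall e, R e e) ->
  exists s : seq T, [/\ forall e, e \in s -> Q e,
    Defs.pairwiseP (fun e f => ~ R e f) s &
    forall e, e \in E -> Q e -> exists f, f \in s /\ R e f].
Proof.
move=> Rr; elim: E => [|e E [s [sQ sP sE]]]; first by exists [::].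
have [[Qe nR]|H] := excluded_middle_informative
    (Q e /\ forall f, f \in s -> ~ R e f).
  exists (e :: s); split=> //= [f|f].
    by rewrite inE => /predU1P[->|/sQ].
  rewrite inE => /predU1P[-> _|fE Qf].
    by exists e; rewrite inE eqxx.
  by have [h [hs Rh]] := sE _ fE Qf; exists h; rewrite inE hs orbT.
exists s; split=> // f; rewrite inE => /predU1P[-> Qe|]; last exact: sE.
apply: NNPP => nE; apply: H; split=> // f' fs Rf; apply: nE; by exists f'.
Qed.

(** Finiteness of the core graph: representatives of its edges are selected among the generator
    edges. *)
Lemma core_nedges_exists gens : exists n, core_nedges gens n.
Proof.
have [K1 KM KV] := gsub_subgroup gens.
pose E := [seq (val e.1, e.2) | e <- generator_edges gens] : seq (word B * B).
have [e|s [sQ sP sE]] := @pairwise_representatives _ (same_edge gens)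
   (fun e => core_edge gens e.1 e.2) E.
  by split=> //; apply/same_cosetE; rewrite mulgV.
exists (size s), s; split=> //; split=> //; split=> // x b Hx.
have Dx := (core_edgeE gens x b).1 Hx.
have [[g c] fin [/= Eb Kf]] := core_dir_generator_edges Dx; subst c.
case: (sE (val g, b)) => [||[y c] [fs [/= Ec /same_cosetE Ky]]].
- by apply/mapP; exists (g, b).
- apply/core_edgeE; rewrite clsK; apply: core_dir_coset Dx.
    exact: gsub_subgroup.
  by move/KV: Kf; congr (gsub _); gnorm.
exists (y, c); split=> //; split=> //=; apply/same_cosetE.
by move: (KM _ _ Kf Ky); rewrite clsK /=; congr (gsub _); gnorm.
Qed.

End Subgroups.

(** * Subgroups elliptic in a free splitting *)

Section Elliptic.
Variable B : finType.
Implicit Types (a c x l : letter B) (u v w p q s m : word B).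
Notation F := (free_group B).
Implicit Types (g h k y z : F) (K : F -> Prop) (P Q : pred B).

Lemma not_wover_split P w : ~~ wover P w ->
  exists u c v, [/\ w = u ++ c :: v, wover P u & ~~ P c.1].
Proof.
elim: w => //= a w IH; rewrite negb_and; have [Pa /=|Pa _] := boolP (P a.1).
  move/IH => [u [c [v [-> Pu Pc]]]]; exists (a :: u), c, v.
  by rewrite /wover /= Pa.
by exists [::], a, w.
Qed.

(** Letters of different types never cancel, so both junctions of the cyclic word are reduced. *)
Lemma amalgam_cyc_reduced P s c m : reducedb s -> s != [::] -> wover P s ->
  reducedb (c :: m) -> ~~ P c.1 -> ~~ P (last c m).1 ->
  cyc_reduced (s ++ c :: m).
Proof.
have sep a d : P a.1 -> ~~ P d.1 -> no_backtrack a d.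
  by move=> Pa; apply: contra => /eqP->.
have sep' a d : P a.1 -> ~~ P d.1 -> no_backtrack d a.
  by move=> Pa Pd; rewrite /no_backtrack inverse_pairC; apply: sep.
case: s => // a s; rewrite !reducedbE cyc_reducedE => Rs _ Ps Rm Pc Pl.
rewrite /= rcons_cat cat_path /= rcons_path.
move: Rs Rm => /= -> -> /=; rewrite (sep' a) //; last by case/andP: Ps.
by rewrite (sep _ c) //; have /allP := Ps; apply; apply: mem_last.
Qed.

(** If [g] fixed another vertex of the Bass-Serre tree than [u], their product would be hyperbolic:
    a suitable conjugate is a cyclically reduced word with letters of both types, which the third
    hypothesis excludes. *)
Lemma wover_of_wover P Q K u g : is_subgroup K -> (forall b, Q b = ~~ P b) ->
  (forall w z, cyc_reduced w -> K (z * cls w * z^-1) -> wover P w || wover Q w) ->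
  reducedb u -> u != [::] -> wover P u -> K (cls u) -> K g -> wover P (val g).
Proof.
move=> [K1 KM KV] QE mono Ru u0 Pu Ku Kg; apply: contraT => nP.
(* Conjugation by [p0] keeps [u] in the factor on [P] and turns [g] into a reduced word with both
   end letters outside [P]. *)
have key p0 c m : wover P p0 -> reducedb (c :: m) -> ~~ P c.1 ->
    ~~ P (last c m).1 -> g = cls p0 * cls (c :: m) * (cls p0)^-1 -> False.
  move=> Pp Rm Pc Pl Eg; pose s := red (winv p0 ++ u ++ p0).
  have Es : cls s = (cls p0)^-1 * cls u * cls p0.
    by rewrite cls_red !cls_cat cls_winv mulgA.
  have s0 : s != [::].
    apply: contraNneq u0 => s0; rewrite -(red_reduced Ru) -val_cls.
    suff -> : cls u = 1 by [].
    apply: (@mulgI _ (cls p0)^-1); apply: (@mulIg _ (cls p0)).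
    by rewrite -Es s0 cls_nil; gnorm.
  have Ps : wover P s by rewrite wover_red // !wover_cat wover_winv Pp Pu.
  have C := amalgam_cyc_reduced (reducedb_red _) s0 Ps Rm Pc Pl.
  have /orP[] : wover P (s ++ c :: m) || wover Q (s ++ c :: m).
  - apply: (mono _ (cls p0)) => //.
    by move: (KM _ _ Ku Kg); congr K; rewrite Eg cls_cat Es; gnorm.
  - by rewrite wover_cat /wover /= (negbTE Pc) andbF.
  - case: (s) s0 Ps => // a t _; rewrite wover_cat /wover /= => /andP[Pa _].
    by rewrite QE Pa.
have [p [w [Eg C]]] := cyc_reduced_decomposition (valP g).
have EgF : g = cls p * cls w * (cls p)^-1.
  by rewrite -{1}[g]clsK Eg !cls_cat cls_winv mulgA.
have [Pp|nPp] := boolP (wover P p).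
  have nPw : ~~ wover P w.
    by move: nP; rewrite Eg !wover_cat wover_winv Pp andbT.
  have Qw : wover Q w.
    have := mono w (cls p) C; rewrite -EgF => /(_ Kg).
    by rewrite (negbTE nPw).
  case: w nPw C Eg EgF Qw => // c m _ C _ EgF Qw; case: (key p c m) => //.
  - exact: cyc_reducedW.
  - by rewrite -QE; case/andP: Qw.
  - by rewrite -QE; have /allP := Qw; apply; apply: mem_last.
(* Here [p0] is the longest prefix of [p] over [P]; conjugated by it, [g] starts with [c] and ends
   with the inverse of [c]. *)
have [p0 [c [p1 [Ep Pp0 Pc]]]] := not_wover_split nPp.
have Ev : val g = p0 ++ c :: (p1 ++ w ++ winv p1 ++ [:: inv_letter c]) ++ winv p0.
  by rewrite Eg Ep winv_cat winv_cons -!catA /= -?catA.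
case: (key p0 c (p1 ++ w ++ winv p1 ++ [:: inv_letter c])) => //.
- have := valP g; rewrite Ev !reducedbE -cat_cons.
  by move/cat_sorted2 => [_ /cat_sorted2[]].
- by rewrite !catA cats1 last_rcons.
- by rewrite -{1}[g]clsK Ev -cat_cons !cls_cat cls_winv mulgA.
Qed.

(** Edge stabilisers are trivial, so a nontrivial elliptic element fixes a single vertex; it
    determines the factor and the conjugator [z] for the whole subgroup. *)
Lemma elliptic P Q K : is_subgroup K -> (forall b, Q b = ~~ P b) ->
  (forall w z, cyc_reduced w -> K (z * cls w * z^-1) -> wover P w || wover Q w) ->
  exists z, (forall k, K k -> wover P (val (z^-1 * k * z))) \/
            (forall k, K k -> wover Q (val (z^-1 * k * z))).
Proof.
move=> [K1 KM KV] QE mono.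
have [[k [Kk k1]]|H] := excluded_middle_informative (exists k, K k /\ k != 1);
  last first.
  exists 1; left => k Kk; have -> : k = 1.
    by apply/eqP; apply: contraT => k1; case: H; exists k.
  by gnorm; rewrite val_cls.
have [p [w [Ek C]]] := cyc_reduced_decomposition (valP k).
have EkF : k = cls p * cls w * (cls p)^-1.
  by rewrite -{1}[k]clsK Ek !cls_cat cls_winv mulgA.
have w0 : w != [::].
  by apply: contraNneq k1 => w0; rewrite EkF w0 cls_nil mulg1 mulgV.
pose K' g := K (cls p * g * (cls p)^-1).
have sK' : is_subgroup K'.
  split=> [|g h Kg Kh|g /KV]; rewrite /K' ?mulg1 ?mulgV //.
    by move: (KM _ _ Kg Kh); congr K; gnorm.
  by congr K; gnorm.
have Kw : K' (cls w) by rewrite /K' -EkF.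
have mono' u z : cyc_reduced u -> K' (z * cls u * z^-1) -> wover P u || wover Q u.
  move=> Cu; rewrite /K' => Ku; apply: (mono u (cls p * z)) => //.
  by move: Ku; congr K; gnorm.
have EK h : K h -> K' ((cls p)^-1 * h * cls p).
  by rewrite /K'; congr K; gnorm.
have K1w : K' (1 * cls w * 1^-1) by gnorm.
exists (cls p); case/orP: (mono' w 1 C K1w) => [Pw|Qw].
- left=> h /EK; apply: (wover_of_wover sK' QE mono' _ w0 Pw Kw).
  exact: cyc_reducedW.
- have PE b : P b = ~~ Q b by rewrite QE negbK.
  right=> h /EK; apply: (wover_of_wover sK' PE _ _ w0 Qw Kw).
    by move=> c z Cc /mono'; rewrite orbC; apply.
  exact: cyc_reducedW.
Qed.

End Elliptic.

(** * Whitehead automorphisms *)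

Section Automorphisms.
Variable B : finType.
Implicit Types (x l : letter B) (u v w : word B).
Notation F := (free_group B).
Implicit Types (g h k y z : F) (f : F -> F).

Definition is_gaut f :=
  [/\ {morph f : g h / g * h}, injective f & forall h, exists g, f g = h].

Lemma morph1 f : {morph f : g h / g * h} -> f 1 = 1.
Proof. by move=> fM; apply: (@mulgI _ (f 1)); rewrite -fM !mulg1. Qed.

Lemma morphV f : {morph f : g h / g * h} -> {morph f : g / g^-1}.
Proof.
by move=> fM g; apply: (@mulgI _ (f g)); rewrite -fM !mulgV morph1.
Qed.

Lemma morphX f n : {morph f : g h / g * h} -> {morph f : g / g ^+ n}.
Proof.
by move=> fM g; elim: n => [|n IH]; rewrite ?morph1 // !expgS fM IH.
Qed.

(** [gaut] and [waut] pass between automorphisms on words up to reduction and automorphisms of the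
    group of normal forms. *)
Definition gaut (alpha : word B -> word B) g : F := cls (alpha (val g)).

Lemma gautE alpha w : is_aut alpha -> cls (alpha w) = gaut alpha (cls w).
Proof. by case=> H _; apply/eqF_cls/H; rewrite /eqF val_cls redK. Qed.

Lemma gaut_is_gaut alpha : is_aut alpha -> is_gaut (gaut alpha).
Proof.
move=> aut; have [_ [HM [Hi Hs]]] := aut; split=> [g h|g h|h].
- rewrite -{1}[g]clsK -{1}[h]clsK -cls_cat -gautE //.
  by move/eqF_cls: (HM (val g) (val h)) => ->; rewrite cls_cat.
- move/eqF_cls/Hi; rewrite /eqF !red_reduced ?(valP g) ?(valP h) //.
  exact: val_inj.
- have [u Hu] := Hs (val h); exists (cls u); rewrite -gautE //.
  by move/eqF_cls: Hu => ->; rewrite clsK.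
Qed.

Definition waut f w : word B := val (f (cls w)).

Lemma waut_is_aut f : is_gaut f -> is_aut (waut f).
Proof.
case=> fM fi fs; split; [|split; [|split]].
- by move=> u v /eqF_cls E; rewrite /eqF /waut E.
- by move=> u v; apply/eqF_cls; rewrite cls_cat !clsK cls_cat fM.
- by move=> u v /eqF_cls; rewrite !clsK => /fi E; apply/eqF_cls.
- by move=> v; have [g E] := fs (cls v); exists (val g);
    apply/eqF_cls; rewrite !clsK E.
Qed.

Lemma gaut_waut f g : gaut (waut f) g = f g.
Proof. by rewrite /gaut /waut !clsK. Qed.

Definition image_sub f (K : F -> Prop) g := exists2 h, K h & g = f h.

Lemma image_subgroup f K : {morph f : g h / g * h} ->
  is_subgroup K -> is_subgroup (image_sub f K).
Proof.
move=> fM [K1 KM KV]; split=> [|_ _ [g Kg ->] [h Kh ->]|_ [g Kg ->]].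
- by exists 1; rewrite ?morph1.
- by exists (g * h); [apply: KM | rewrite fM].
- by exists g^-1; [apply: KV | rewrite morphV].
Qed.

Lemma image_subE f K g : injective f -> image_sub f K (f g) <-> K g.
Proof. by move=> fi; split=> [[h Kh /fi ->] //|Kg]; exists g. Qed.

Lemma gsub_map alpha (gens : seq (word B)) g : is_aut alpha ->
  gsub (map alpha gens) g <-> image_sub (gaut alpha) (gsub gens) g.
Proof.
move=> aut; have [fM fi fs] := gaut_is_gaut aut.
have [K1 KM KV] := gsub_subgroup gens.
have [L1 LM LV] := gsub_subgroup (map alpha gens).
have gensP u : u \in gens -> gsub gens (cls u).
  by move=> ui; apply/gsubP; exists u; rewrite // -[u]cats0; apply/gen_gen/gen_one.
have mapP' u : u \in map alpha gens -> gsub (map alpha gens) (cls u).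
  by move=> ui; apply/gsubP; exists u; rewrite // -[u]cats0; apply/gen_gen/gen_one.
split=> [/gsubP[w Hw ->]|[h /gsubP[w Hw ->] ->]].
  elim: Hw => [|_ v /mapP[u ui ->] _ [h Kh E]|_ v /mapP[u ui ->] _ [h Kh E]].
  - by exists 1; rewrite ?morph1.
  - exists (cls u * h); first by apply: KM => //; apply: gensP.
    by rewrite cls_cat gautE // fM E.
  - exists ((cls u)^-1 * h); first by apply: KM => //; apply/KV/gensP.
    by rewrite cls_cat cls_winv gautE // fM E morphV.
elim: Hw => [|u v ui _ IH|u v ui _ IH].
- by rewrite morph1.
- rewrite cls_cat fM; apply: LM => //; rewrite -gautE //.
  exact/mapP'/map_f.
- rewrite cls_cat cls_winv fM morphV //; apply: LM => //; rewrite -gautE //.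
  exact/LV/mapP'/map_f.
Qed.

(** * Universal property of the free group *)

Section Extension.
Variable f : letter B -> F.
Hypothesis fV : forall x, f (inv_letter x) = (f x)^-1.

Definition wext w : F := foldr (fun x g => f x * g) 1 w.

Lemma wext_cat u v : wext (u ++ v) = wext u * wext v.
Proof. by elim: u => [|x u IH] /=; rewrite ?mul1g // IH mulgA. Qed.

Lemma wext_red w : wext (red w) = wext w.
Proof.
elim: w => // x w /= <-; case: (red w) => [|c r] //=.
by case: ifP => //= /eqP ->; rewrite fV mulgA mulgV mul1g.
Qed.

Definition gext g : F := wext (val g).

Lemma gext_cls w : gext (cls w) = wext w.
Proof. by rewrite /gext val_cls wext_red. Qed.

Lemma gextM : {morph gext : g h / g * h}.
Proof. by move=> g h; rewrite /gext val_mul wext_red wext_cat. Qed.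

Lemma gext_letter x : gext (cls [:: x]) = f x.
Proof. by rewrite gext_cls /= mulg1. Qed.

End Extension.

Lemma morph_letters f1 f2 : {morph f1 : g h / g * h} ->
  {morph f2 : g h / g * h} -> (forall x, f1 (cls [:: x]) = f2 (cls [:: x])) ->
  f1 =1 f2.
Proof.
move=> m1 m2 E g; rewrite -[g]clsK; elim: (val g) => [|x w IH].
  by rewrite cls_nil !morph1.
by rewrite cls_cons m1 m2 E IH.
Qed.

End Automorphisms.

(** Pigeonhole for counting up to [R1]: [R] acts as a multivalued map into [s2] that is injective on
    classes. *)
Lemma size_related (T1 T2 : eqType) (R1 : T1 -> T1 -> Prop) (R : T1 -> T2 -> Prop)
    (s1 : seq T1) (s2 : seq T2) : Defs.pairwiseP (fun e f => ~ R1 e f) s1 ->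
  (forall e, e \in s1 -> exists2 f, f \in s2 & R e f) ->
  (forall e e' f, R e f -> R e' f -> R1 e e') -> size s1 <= size s2.
Proof.
move=> P1 H1 H2; elim: s1 s2 P1 H1 => //= e s1 IH s2 [ne P1] H1.
have [f fs Ref] := H1 e (mem_head _ _).
have sz : size s2 = (size (rem f s2)).+1.
  by rewrite size_rem // prednK //; case: (s2) fs.
rewrite sz ltnS; apply: IH => // e' e's.
have [|f' f's Re'] := H1 e'; first by rewrite inE e's orbT.
exists f' => //; apply: rem_mem => //; apply/eqP => E; subst f'.
exact: ne e's (H2 _ _ _ Ref Re').
Qed.

(** * The Whitehead automorphism of a cut and the core graphs of image subgroups *)

Section Whitehead.
Variables (B : finType) (Z : pred (letter B)) (b0 : B).
Hypotheses (Zt : Z (b0, true)) (Zf : ~~ Z (b0, false)).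
Implicit Types (x l : letter B) (u v w : word B).
Notation F := (free_group B).
Implicit Types (g h k y z : F) (K : F -> Prop).

Let a : F := cls [:: (b0, true)].
Let ap (s : bool) : F := if s then a else 1.
Let hat x : word B := if x.1 == b0 then [::] else [:: x].

(** Each vertex splits into two ends joined by a new [b0]-edge, and [ap (Z x)] leads to the end
    carrying the direction [x]. As [hat] erases [b0], the same formula fixes [b0]: its letter comes
    from [ap]. *)
Definition wh_letter x : F := ap (Z x) * cls (hat x) * (ap (Z (inv_letter x)))^-1.

Definition wh_inv_letter x : F :=
  if x.1 == b0 then cls [:: x]
  else (ap (Z x))^-1 * cls [:: x] * ap (Z (inv_letter x)).

Let hatV x : cls (hat (inv_letter x)) = (cls (hat x))^-1.
Proof.
by rewrite /hat /=; case: ifP => _; rewrite ?cls_nil ?invg1 // cls_inv_letter.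
Qed.

Lemma wh_letterV x : wh_letter (inv_letter x) = (wh_letter x)^-1.
Proof. by rewrite /wh_letter inv_letterK hatV; gnorm. Qed.

Lemma wh_inv_letterV x : wh_inv_letter (inv_letter x) = (wh_inv_letter x)^-1.
Proof.
by rewrite /wh_inv_letter inv_letterK /= !cls_inv_letter; case: ifP => _; gnorm.
Qed.

Lemma wh_letter_b0 s : wh_letter (b0, s) = cls [:: (b0, s)].
Proof.
rewrite /wh_letter /hat /= eqxx cls_nil /inv_letter /=.
case: s; rewrite /= Zt (negbTE Zf) /= /a; gnorm.
by rewrite -cls_inv_letter.
Qed.

Definition wh := gext wh_letter.
Let wh_inv := gext wh_inv_letter.

Lemma whM : {morph wh : g h / g * h}.
Proof. exact: gextM wh_letterV. Qed.

Let wh_invM : {morph wh_inv : g h / g * h}.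
Proof. exact: gextM wh_inv_letterV. Qed.

Let wh_ap s : wh (ap s) = ap s.
Proof.
case: s; last exact: morph1 whM.
by rewrite /ap /a /wh (gext_letter wh_letterV) wh_letter_b0.
Qed.

Let wh_inv_ap s : wh_inv (ap s) = ap s.
Proof.
case: s; last exact: morph1 wh_invM.
by rewrite /ap /a /wh_inv (gext_letter wh_inv_letterV) /wh_inv_letter eqxx.
Qed.

Let wh_letterE x : x.1 != b0 ->
  wh (cls [:: x]) = ap (Z x) * cls [:: x] * (ap (Z (inv_letter x)))^-1.
Proof.
by move=> xb; rewrite /wh (gext_letter wh_letterV) /wh_letter /hat (negbTE xb).
Qed.

Let wh_invK : cancel wh_inv wh.
Proof.
apply: (@morph_letters _ (wh \o wh_inv) id) => // [g h|x] /=.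
  by rewrite wh_invM whM.
rewrite /wh_inv (gext_letter wh_inv_letterV) /wh_inv_letter.
case: eqVneq => [|xb]; last first.
  by rewrite !whM (morphV whM) !wh_ap (wh_letterE xb); gnorm.
case: x => b s /= ->.
by rewrite /wh (gext_letter wh_letterV) wh_letter_b0.
Qed.

Let whK : cancel wh wh_inv.
Proof.
apply: (@morph_letters _ (wh_inv \o wh) id) => // [g h|x] /=.
  by rewrite whM wh_invM.
have [|xb] := eqVneq x.1 b0; last first.
  rewrite (wh_letterE xb) !wh_invM (morphV wh_invM) !wh_inv_ap.
  rewrite /wh_inv (gext_letter wh_inv_letterV) /wh_inv_letter (negbTE xb).
  by gnorm.
case: x => b s /= ->; rewrite /wh (gext_letter wh_letterV) wh_letter_b0.
by rewrite /wh_inv (gext_letter wh_inv_letterV) /wh_inv_letter eqxx.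
Qed.

Lemma wh_is_gaut : is_gaut wh.
Proof.
split; [exact: whM | exact: can_inj whK | by move=> h; exists (wh_inv h)].
Qed.

Let turn (s t : bool) : word B := if s == t then [::] else [:: (b0, t)].

Let cls_turn s t : cls (turn s t) = (ap s)^-1 * ap t.
Proof.
case: s; case: t; rewrite /turn /ap /= ?cls_nil; gnorm.
by rewrite /a -cls_inv_letter.
Qed.

(* The image of a path: at each vertex the new [b0]-edge is crossed exactly when
   the incoming and outgoing directions lie on different sides of [Z], and the
   old [b0]-edges are collapsed. *)
Fixpoint trail (pr : letter B) w : word B :=
  if w is x :: w' then turn (Z (inv_letter pr)) (Z x) ++ hat x ++ trail x w'
  else [::].

(** The factors [ap] at consecutive letters cancel, so only those at the two ends of the path
    remain. *)
Lemma cls_trail pr w : ap (Z (inv_letter pr)) * cls (trail pr w) =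
  wh (cls w) * ap (Z (inv_letter (last pr w))).
Proof.
elim: w pr => [|x w IH] pr /=; first by rewrite cls_nil (morph1 whM); gnorm.
rewrite (cls_cons x) whM -mulgA -IH !cls_cat cls_turn.
by rewrite /wh (gext_letter wh_letterV) /wh_letter; gnorm.
Qed.

(** The first case is a new edge at a split vertex, the second a surviving old edge; its factor [ap]
    tells to which end of the split origin it is attached. *)
Lemma edges_trail z pr w e :
  e \in edges (wh z * ap (Z (inv_letter pr))) (trail pr w) ->
  exists u x v, w = u ++ x :: v /\
   ([/\ e.2 = b0, Z (inv_letter (last pr u)) != Z x & e.1 = wh (z * cls u)] \/
    [/\ e.2 != b0, x.1 = e.2 & e.1 =
      wh (if x.2 then z * cls u else z * cls u * cls [:: x]) * ap (Z (e.2, true))]).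
Proof.
elim: w z pr => //= x w IH z pr; rewrite !edges_cat !mem_cat cls_turn.
set y := _ * (_ * _); have -> : y = wh z * ap (Z x) by rewrite /y; gnorm.
case/or3P => [||He].
- rewrite /turn; case: eqP => // /eqP nZ; rewrite inE => /eqP ->.
  exists [::], x, w; split=> //; left; split=> //.
  rewrite cls_nil mulg1 /edge_at /=; case: (Z x) nZ; case: (Z _) => //= _.
    by rewrite mulg1.
  (* Leaving the [Z] side reads [b0] backwards, so the origin is the vertex after the step. *)
  by rewrite -[cls [:: _]]/(cls [:: inv_letter (b0, true)]) cls_inv_letter mulgK.
- rewrite /hat; have [//|xb] := eqVneq x.1 b0; rewrite inE => /eqP ->.
  exists [::], x, w; split=> //; right; split=> //.
  rewrite cls_nil mulg1 /edge_at /=; case: ifP => x2.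
    by rewrite -x2 -surjective_pairing.
  rewrite whM (wh_letterE xb); have -> : (x.1, true) = inv_letter x.
    by rewrite /inv_letter x2.
  by gnorm.
- move: He; set y' := _ * cls (hat x).
  have -> : y' = wh (z * cls [:: x]) * ap (Z (inv_letter x)).
    by rewrite whM /wh (gext_letter wh_letterV) /wh_letter /y'; gnorm.
  move/IH=> [u [x' [v [-> H]]]]; exists (x :: u), x', v; split=> //.
  by rewrite (cls_cons x u) mulgA.
Qed.

Definition crossing K g :=
  exists l1 l2, [/\ core_dir K g l1, core_dir K g l2, Z l1 & ~~ Z l2].

Lemma crossing_coset K g h :
  is_subgroup K -> K (h * g^-1) -> crossing K g -> crossing K h.
Proof.
move=> sK Kh [l1 [l2 [D1 D2 Z1 Z2]]]; exists l1, l2.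
by split=> //; apply: core_dir_coset Kh _.
Qed.

(** An immersed loop of the image is pulled back and cyclically reduced to a loop [w] of [K]; the
    axis of the image loop then lies on the trail of a power of [w], whose edges are known. *)
Lemma core_dir_wh K g b : is_subgroup K -> core_dir (image_sub wh K) g (b, true) ->
  (b != b0 -> exists2 h, core_dir K h (b, true)
     & image_sub wh K (g * (wh h * ap (Z (b, true)))^-1)) /\
  (b = b0 -> exists2 h, crossing K h & image_sub wh K (g * (wh h)^-1)).
Proof.
move=> sK [t [C Kg]]; have [_ whI whS] := wh_is_gaut.
have [K1 KM KV] := sK; have [L1 LM LV] := image_subgroup whM sK.
have KX h n : K h -> K (h ^+ n).
  by move=> Kh; elim: n => // n IHn; rewrite expgS; apply: KM.
have LX h n : image_sub wh K h -> image_sub wh K (h ^+ n).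
  by move=> Kh; elim: n => // n IHn; rewrite expgS; apply: LM.
set w' := (b, true) :: t in C Kg.
have [g1 Eg1] := whS g; have [h1 Eh1] := whS (cls w').
have [p [w [Eh C1]]] := cyc_reduced_decomposition (valP h1).
have Eh1F : h1 = cls p * cls w * (cls p)^-1.
  by rewrite -{1}[h1]clsK Eh !cls_cat cls_winv mulgA.
pose z0 := g1 * cls p.
have Kw : K (z0 * cls w * z0^-1).
  apply/(@image_subE _ wh) => //; move: Kg; congr (image_sub wh K).
  rewrite -Eg1 -Eh1 Eh1F /z0 -(morphV whM) -!whM; congr wh; gnorm.
have w0 : w != [::].
  have : cls w' != 1.
    apply/eqP => /(congr1 val); rewrite val_cls red_reduced //.
    exact: cyc_reducedW.
  by apply: contraNneq => w0; rewrite -Eh1 Eh1F w0 cls_nil mulg1 mulgV (morph1 whM).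
(* [w] is entered through its own last letter, so its powers have trails with equal ends; the
   default is never reached because [w] is nonempty. *)
pose pr := last (b0, true) w.
have lastw m : last pr (wpow w m) = pr.
  elim: m => // m IHm; rewrite wpowS last_cat.
  suff -> : last pr w = pr by [].
  by rewrite /pr; case: (w) w0.
pose s := ap (Z (inv_letter pr)).
pose p' := val (wh (cls p) * s).
pose n := (size p').*2.+1.
have En : cls w' ^+ n = cls p' * cls (trail pr (wpow w n)) * (cls p')^-1.
  have := cls_trail pr (wpow w n); rewrite lastw -/s => Et.
  rewrite /p' clsK -(mulgA _ s) Et cls_wpow -Eh1 Eh1F -(morphX _ whM) expg_conj.
  by rewrite !whM (morphV whM); gnorm.
have sub := edges_axis (y := g) C (ltnSn _) En.
have He := sub (g * cls w' ^+ size p', b).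
rewrite /= inE eqxx in He; move: (He isT) => {sub}{}He.
have Ep' : g * cls p' = wh z0 * s by rewrite /p' clsK -Eg1 /z0 whM; gnorm.
rewrite Ep' in He; have [u [x [v [Ew H]]]] := edges_trail He.
have Kn : K (z0 * cls (u ++ x :: v) * z0^-1).
  by rewrite -Ew cls_wpow -expg_conj; apply: KX.
have Cn : cyc_reduced (u ++ x :: v) by rewrite -Ew; apply: cyc_reduced_wpow.
have Kback : image_sub wh K (g * (g * cls w' ^+ size p')^-1).
  have := LV _ (LX _ (size p') Kg); rewrite expg_conj.
  by congr (image_sub wh K); gnorm.
have D := core_dir_rot Cn Kn.
split=> bb; case: H => [[/= E nZ E1]|[/= E xb E1]].
- by rewrite E eqxx in bb.
- case x2: x.2 E1 => E1.
    exists (z0 * cls u); last by rewrite -E1; exact: Kback.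
    by move: D; case: x x2 xb {Ew Kn Cn E1} => ? [] //= _ ->.
  exists (z0 * cls u * cls [:: x]); last by rewrite -E1; exact: Kback.
  move: (core_dir_flip sK D).
  by case: x x2 xb {Ew Kn Cn E1 D} => ? [] //= _ ->.
- exists (z0 * cls u); last by rewrite -E1; exact: Kback.
  (* The reverse of the incoming letter is a core direction too: that letter closes the loop rotated
     to start at [x], also when [u] is empty. *)
  have D' : core_dir K (z0 * cls u) (inv_letter (last pr u)).
    have -> : last pr u = last x (v ++ u).
      by have := lastw n; rewrite Ew !last_cat /= => ->.
    apply: (@core_dir_inv_last _ _ _ (belast x (v ++ u))) => //; rewrite -lastI.
      by rewrite -cat_cons; apply: cyc_reduced_rot.
    by move: Kn; rewrite -cat_cons !cls_cat; congr K; gnorm.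
  case Zx: (Z x) nZ; case Zl: (Z (inv_letter _)) => //= _.
    by exists x, (inv_letter (last pr u)); rewrite Zx Zl.
  by exists (inv_letter (last pr u)), x; rewrite Zx Zl.
- by rewrite bb eqxx in E.
Qed.

Section OneSided.
Variable s : bool.

(** The end of the [b0]-edge with origin [g] at which its direction is [(b0, s)]. *)
Let base g := if s then g else g * a.
(** Chosen at [b0] so that [wh h * tau b0 = wh (base h)]. *)
Let tau b : F := if b == b0 then ap (~~ s) else ap (Z (b, true)).

(** A new [b0]-edge is matched with the old [b0]-edge leaving its crossing vertex in direction
    [(b0, s)]; every other edge is matched with the old edge it comes from. *)
Lemma core_dir_wh_edge K g b : is_subgroup K ->
  (forall h, crossing K h -> core_dir K h (b0, s)) ->
  core_dir (image_sub wh K) g (b, true) ->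
  exists h, [/\ core_dir K h (b, true),
    image_sub wh K (g * (wh h * tau b)^-1) & b = b0 -> crossing K (base h)].
Proof.
move=> sK cr /(core_dir_wh sK)[H1 H2]; rewrite /tau.
have [Eb|bb] := eqVneq b b0; last first.
  have [h D Kh] := H1 bb; exists h; split=> // Eb.
  by rewrite Eb eqxx in bb.
have [h X Kh] := H2 Eb; have D := cr _ X; rewrite Eb /base.
have aV : cls [:: (b0, false)] = a^-1 by rewrite /a -cls_inv_letter.
case: s D => D.
  by exists h; rewrite /= mulg1.
exists (h * a^-1); split=> [||_]; last by gnorm.
  by have := core_dir_flip sK D; rewrite aV.
rewrite /= whM (morphV whM); have -> : wh a = a by rewrite -[a]/(ap true) wh_ap.
by gnorm.
Qed.

(** The matching is injective on edge classes. It misses an old [b0]-edge that leaves a vertex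
    without crossing in direction [(b0, s)], and the count then drops. *)
Lemma wh_core_nedges gens n n' :
  let alpha := waut wh in
  (forall h, crossing (gsub gens) h -> core_dir (gsub gens) h (b0, s)) ->
  core_nedges gens n -> core_nedges (map alpha gens) n' ->
  n' <= n /\ forall h, core_dir (gsub gens) h (b0, s) ->
    ~ crossing (gsub gens) h -> n' < n.
Proof.
move=> alpha cr [t [<- [tQ [tP tE]]]] [t' [<- [t'Q [t'P t'E]]]].
have sK := gsub_subgroup gens; have [K1 KM KV] := sK.
set K := gsub gens in cr sK K1 KM KV *.
have [_ whI _] := wh_is_gaut.
have [L1 LM LV] := image_subgroup whM sK.
have autA : is_aut alpha := waut_is_aut wh_is_gaut.
have LE g : gsub (map alpha gens) g <-> image_sub wh K g.
  rewrite (gsub_map _ _ autA); split=> [[h Kh ->]|[h Kh ->]]; exists h => //;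
  by rewrite gaut_waut.
have Ldir g l : core_dir (gsub (map alpha gens)) g l -> core_dir (image_sub wh K) g l.
  by case=> w [C /LE L]; exists w.
pose R (e' e : word B * B) :=
  e'.2 = e.2 /\ image_sub wh K (cls e'.1 * (wh (cls e.1) * tau e.2)^-1).
have Rinj e e' f : R e f -> R e' f -> same_edge (map alpha gens) e e'.
  move=> [E1 L] [E2 L']; split; first by rewrite E1.
  apply/same_cosetE/LE; move: (LM _ _ L (LV _ L')).
  by congr (image_sub wh K); gnorm.
have Rex e : e \in t' -> exists2 f, f \in t & R e f.
  case: e => x b /t'Q /core_edgeE /Ldir /(core_dir_wh_edge sK cr)[h [D L _]].
  have [|[y c] [ft [/= Ec /same_cosetE]]] := tE (val h) b.
    by apply/core_edgeE; rewrite clsK.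
  rewrite clsK => Ky; exists (y, c) => //; split=> //=; subst c.
  have LK : image_sub wh K (wh h * (wh (cls y))^-1).
    by exists (h * (cls y)^-1) => //; rewrite whM (morphV whM).
  by move: (LM _ _ L LK); congr (image_sub wh K); gnorm.
split; first exact: size_related t'P Rex Rinj.
move=> h D nC.
pose X := if s then h else h * a^-1.
have baseX : base X = h by rewrite /base /X; case: s; gnorm.
have DX : core_dir K X (b0, true).
  rewrite /X; case: s D => // D; have := core_dir_flip sK D.
  by rewrite /a -cls_inv_letter.
have [|[y c] [ft [/= Ec /same_cosetE]]] := tE (val X) b0.
  by apply/core_edgeE; rewrite clsK.
rewrite clsK => Ky; subst c.
have sz : size t = (size (rem (y, b0) t)).+1.
  by rewrite size_rem // prednK //; case: (t) ft.
(* The matching lands in [t] without the edge over [X]: a new edge matched with it would make [h]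
   crossing. *)
rewrite sz ltnS; apply: (@size_related _ _ _ R) t'P _ Rinj => e et.
have [f fs Ref] := Rex _ et; exists f => //; apply: rem_mem => //.
apply/eqP => E; subst f; case: Ref => /= Eb L; apply: nC.
have /core_edgeE /Ldir := t'Q _ et.
move=> /(core_dir_wh_edge sK cr)[h' [_ L' /(_ Eb) C']].
apply: crossing_coset C' => //; rewrite -baseX.
have KyX : K (cls y * h'^-1).
  apply/(@image_subE _ wh) => //; rewrite whM (morphV whM).
  by move: (LM _ _ (LV _ L) L'); rewrite Eb; congr (image_sub wh K); gnorm.
by move: (KM _ _ Ky KyX); rewrite /base; case: s; congr K; gnorm.
Qed.

End OneSided.
End Whitehead.

(** * The Whitehead graph at minimal complexity *)

Lemma sumn_ltn (s t : seq nat) : size s = size t ->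
  (forall i, i < size t -> nth 0 s i <= nth 0 t i) ->
  (exists2 i, i < size t & nth 0 s i < nth 0 t i) -> sumn s < sumn t.
Proof.
elim: s t => [|m s IH] [|n t] //= => [_ _ [] //|[sz] le [[|i] it lt]].
- rewrite -addSn leq_add //; have {}le i : i < size t -> nth 0 s i <= nth 0 t i.
    by move=> ?; apply: (le i.+1).
  elim: s t sz le {IH it lt} => [|p s IHs] [|q t] //= [sz] le.
  by rewrite leq_add ?(le 0) ?IHs // => i it; apply: (le i.+1).
- rewrite -addnS leq_add ?(le 0) //; apply: IH => // [j jt|].
    exact: (le j.+1).
  by exists i.
Qed.

Lemma mem_split (T : eqType) (x : T) s : x \in s -> exists u v, s = u ++ x :: v.
Proof. by case/splitPr=> u v; exists u, v. Qed.

Section Minimal.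
Variable B : finType.
Implicit Types (e x y l : letter B) (u v w : word B) (Hs : subgroup_seq B).
Notation F := (free_group B).
Implicit Types (g h k z : F) (C Z : pred (letter B)).

Lemma complexity_exists Hs : exists n, complexity Hs n.
Proof.
elim: Hs => [|H Hs [n [ns [sz [Hn _]]]]]; first by exists 0, [::].
have [m Hm] := core_nedges_exists H.
exists (sumn (m :: ns)), (m :: ns); split; first by rewrite /= sz.
by split=> // -[|i] //= /Hn.
Qed.

Definition minimal_complexity Hs := exists n, complexity Hs n /\
  forall alpha m, is_aut alpha -> complexity (act alpha Hs) m -> n <= m.

Notation sub_at Hs i := (gsub (nth [::] Hs i)).

Lemma whitehead_not_minimal Hs Z b0 s : Z (b0, true) -> ~~ Z (b0, false) ->
  (forall i h, i < size Hs ->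
     crossing Z (sub_at Hs i) h -> core_dir (sub_at Hs i) h (b0, s)) ->
  (exists i h, [/\ i < size Hs, core_dir (sub_at Hs i) h (b0, s) &
     ~ crossing Z (sub_at Hs i) h]) ->
  ~ minimal_complexity Hs.
Proof.
move=> Zt Zf cr [i0 [h0 [i0s D0 nC0]]] [n [[ns [sz [Hns En]]] min]].
pose alpha := waut (wh Z b0).
have [m Hm] := complexity_exists (act alpha Hs).
have := min alpha m (waut_is_aut (wh_is_gaut Zt Zf)) Hm; apply/negP.
rewrite -ltnNge -En; case: Hm => ms [szm [Hms <-]].
have szE : size (act alpha Hs) = size Hs by rewrite size_map.
have step i : i < size Hs -> nth 0 ms i <= nth 0 ns i /\
    forall h, core_dir (sub_at Hs i) h (b0, s) ->
    ~ crossing Z (sub_at Hs i) h -> nth 0 ms i < nth 0 ns i.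
  move=> iH; apply: (wh_core_nedges Zt Zf (cr i ^~ iH)); first exact: Hns.
  by have := Hms i; rewrite szE /act (nth_map [::]) //; apply.
apply: sumn_ltn => [|i|]; rewrite ?sz ?szm ?szE //; first by case/step.
by exists i0 => //; case: (step i0 i0s) => _ /(_ h0 D0 nC0).
Qed.

Definition adjacent Hs x y := exists i h,
  [/\ i < size Hs, core_dir (sub_at Hs i) h x & core_dir (sub_at Hs i) h y].

Lemma adjacentC Hs x y : adjacent Hs x y -> adjacent Hs y x.
Proof. by case=> i [h [iH Dx Dy]]; exists i, h. Qed.

(** A union of components separating the two directions of [b] would be a cut crossed at no vertex;
    its automorphism would create no edge and collapse the existing [b]-edges. *)
Lemma minimal_closed_sym Hs C b : minimal_complexity Hs ->
  (forall x y, adjacent Hs x y -> C x -> C y) ->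
  (exists i h, i < size Hs /\ core_dir (sub_at Hs i) h (b, true)) ->
  C (b, true) = C (b, false).
Proof.
move=> min Cc [i [h [iH D]]]; apply/eqP; apply: contraT => nC.
have Cc' x y : adjacent Hs x y -> C x = C y.
  by move=> A; apply/idP/idP; apply: Cc => //; apply: adjacentC.
(* [C] or its complement, whichever contains [(b, true)]. *)
pose Z x := C x == C (b, true).
have nX j k : j < size Hs -> ~ crossing Z (sub_at Hs j) k.
  move=> jH [l1 [l2 [D1 D2 Z1]]]; rewrite /Z.
  have <- : C l1 = C l2 by apply: Cc'; exists j, k.
  by rewrite -/(Z l1) Z1.
case: (@whitehead_not_minimal Hs Z b true) => //; rewrite /Z ?eqxx //.
- by rewrite eq_sym.
- by move=> j k /nX X /X.
- by exists i, h; split=> // /(nX _ _ iH).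
Qed.

(** Adding [e] to [C] gives a cut all of whose crossing vertices have the direction [e]. A vertex
    with [e] and a direction in [C] is not crossing, so the complexity would drop. *)
Lemma minimal_no_cut Hs C e : minimal_complexity Hs ->
  ~~ C e -> ~~ C (inv_letter e) ->
  (forall x y, y != e -> adjacent Hs x y -> C x -> C y) ->
  forall x y, adjacent Hs x y -> C x -> C y.
Proof.
move=> min Ce Ce' Cc x y A Cx; have [Ey|ye] := eqVneq y e; last exact: (Cc x).
subst y; case: A => i [h [iH Dx Dxe]].
pose D x := C x || (x == e).
(* [D] or its complement, so that [Z] contains [(e.1, true)] and not its inverse. *)
pose Z x := D x == e.2.
have De' : D (inv_letter e) = false.
  by rewrite /D (negbTE Ce') (negbTE (inv_letter_neq e)).
have De : D e by rewrite /D eqxx orbT.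
have out j k l1 l2 : j < size Hs -> core_dir (sub_at Hs j) k l1 ->
    core_dir (sub_at Hs j) k l2 -> C l1 -> D l2.
  move=> jH D1 D2 C1; rewrite /D; have [//|l2e] := eqVneq l2 e.
    by rewrite orbT.
  by rewrite (Cc l1) //; exists j, k.
have cr j k : j < size Hs -> crossing Z (sub_at Hs j) k ->
    exists l1 l2, [/\ core_dir (sub_at Hs j) k l1, core_dir (sub_at Hs j) k l2,
      D l1 & ~~ D l2].
  move=> jH [l1 [l2 [D1 D2]]]; rewrite /Z => /eqP <-.
  case E1: (D l1); case E2: (D l2) => // _.
    by exists l1, l2; rewrite E1 E2.
  by exists l2, l1; rewrite E1 E2.
case: (@whitehead_not_minimal Hs Z e.1 e.2) => //.
- by rewrite /Z; case: (e) De De' => b [] /= De De'; rewrite ?De ?De'.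
- by rewrite /Z; case: (e) De De' => b [] /= De De'; rewrite ?De ?De'.
- move=> j k jH /(cr _ _ jH)[l1 [l2 [D1 D2 /orP[C1|/eqP <-] nD]]].
    by rewrite (out j k l1) in nD.
  by rewrite -surjective_pairing.
- exists i, h; rewrite -surjective_pairing; split=> //.
  move=> /(cr _ _ iH)[l1 [l2 [D1 D2 _]]].
  by rewrite (out i h x).
Qed.

Section NotBlownUp.
Variable Hs : subgroup_seq B.
Hypotheses (min : minimal_complexity Hs) (nb : ~ visibly_blown_up Hs).
Hypothesis two : forall b : B, exists c, c != b.

(** A missing label would by itself form one block of a visible partition. *)
Lemma every_label b : exists i h, i < size Hs /\ core_dir (sub_at Hs i) h (b, true).
Proof.
apply: NNPP => nE; apply: nb; exists (pred1 b); split; first by exists b => /=.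
split; first by have [c cb] := two b; exists c.
move=> i iH; right=> c [x /core_edgeE D]; apply/negP => /eqP E; subst c.
by apply: nE; exists i, (cls x).
Qed.

(** A proper union of components consists of some generators and their inverses. Every immersed
    cycle then has labels of one type, so each subgroup is elliptic and its whole core graph has one
    type: a visible blow-up. *)
Lemma adjacent_connected C x y :
  (forall x y, adjacent Hs x y -> C x -> C y) -> C x -> C y.
Proof.
move=> Cc Cx; apply: contraT => Cy; case: nb.
have Cc' l1 l2 : adjacent Hs l1 l2 -> C l1 = C l2.
  by move=> A; apply/idP/idP; apply: Cc => //; apply: adjacentC.
pose P b := C (b, true).
have CP l : C l = P l.1.
  case: l => b [] //; rewrite /P.
  by rewrite (minimal_closed_sym min Cc (every_label b)).
exists P; split; first by exists x.1; rewrite -CP.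
split; first by exists y.1; rewrite -CP.
move=> i iH; set K := sub_at Hs i.
have sK : is_subgroup K := gsub_subgroup _.
have mono w z : cyc_reduced w -> K (z * cls w * z^-1) ->
    wover P w || wover (fun b => ~~ P b) w.
  case: w => // l t Cw Kw.
  (* Propagation along the cycle: the reverse of [c] and its successor [d] are directions at a
     common core vertex. *)
  have same u d v : l :: t = u ++ d :: v -> P d.1 = P l.1.
    elim/last_ind: u d v => [|u c IH] d v /=; first by case=> <-.
    rewrite cat_rcons => E; rewrite -(IH c (d :: v)) //.
    rewrite E in Cw Kw; rewrite -(CP d) -[c.1]/((inv_letter c).1) -CP.
    apply: Cc'; exists i, (z * cls (rcons u c)); split=> //.
      by apply: (@core_dir_rot _ _ _ _ _ v); rewrite cat_rcons.
    rewrite -cats1 cls_cat mulgA.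
    exact: core_dir_flip (core_dir_rot Cw Kw).
  have all_same d : d \in l :: t -> P d.1 = P l.1.
    by move/mem_split => [u [v /same]].
  by case Pl: (P l.1); apply/orP; [left|right]; apply/allP => d /all_same ->;
    rewrite Pl.
have [z H] := elliptic sK (fun b => erefl (~~ P b)) mono.
(* A loop of the core is cyclically reduced and conjugate to a word over [R], hence itself over
   [R]. *)
have key R : (forall k, K k -> wover R (val (z^-1 * k * z))) ->
    forall b, core_label (nth [::] Hs i) b -> R b.
  move=> HR b [v /core_edgeE [w [Cw Kw]]].
  have /(wover_cyc_conj (P := R) Cw) : cls ((b, true) :: w) =
     ((cls v)^-1 * z) * cls (val (z^-1 * (cls v * cls ((b, true) :: w) * (cls v)^-1) * z))
       * ((cls v)^-1 * z)^-1.
    by rewrite clsK; gnorm.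
  by move=> /(_ (HR _ Kw)) /andP[].
by case: H => H; [left|right] => b; move: b; apply: key.
Qed.

(** Let [D] be [C] or its complement, whichever misses the inverse of [e], with [e] removed. As [e]
    is no cut vertex, [D] is closed in the full graph, and connectedness would put [e] into it. *)
Lemma adjacent_connected_minus e C x y :
  (forall x y, x != e -> y != e -> adjacent Hs x y -> C x -> C y) ->
  x != e -> y != e -> C x -> C y.
Proof.
move=> Cc xe ye Cx; apply: contraT => Cy.
have [Ce|Ce] := boolP (C (inv_letter e)).
  pose D l := ~~ C l && (l != e).
  suff : D e by rewrite /D eqxx andbF.
  apply: (@adjacent_connected D y); last by rewrite /D Cy.
  apply: (minimal_no_cut min (e := e)); rewrite /D ?eqxx ?andbF ?Ce //.
  move=> l1 l2 l2e A /andP[C1 l1e]; rewrite l2e andbT.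
  by apply: contra C1; apply: Cc => //; apply: adjacentC.
pose D l := C l && (l != e).
suff : D e by rewrite /D eqxx andbF.
apply: (@adjacent_connected D x); last by rewrite /D Cx.
apply: (minimal_no_cut min (e := e)); rewrite /D ?eqxx ?andbF ?(negbTE Ce) //.
by move=> l1 l2 l2e A /andP[C1 l1e]; rewrite l2e andbT (Cc l1).
Qed.

(** The letters that prolong [u] without backtracking are all but the inverse of its last letter, so
    this is connectedness with one letter deleted, or with none if [u] is empty. *)
Lemma adjacent_connected_after u C x y : reducedb u ->
  (forall x y, reducedb (rcons u x) -> reducedb (rcons u y) ->
     adjacent Hs x y -> C x -> C y) ->
  reducedb (rcons u x) -> reducedb (rcons u y) -> C x -> C y.
Proof.
move=> Ru; case/lastP: u Ru => [|u e] Ru.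
  by move=> Cc _ _; apply: adjacent_connected => l1 l2; apply: Cc.
have E l : reducedb (rcons (rcons u e) l) = (l != inv_letter e).
  move: Ru; rewrite !reducedbE; case: u => [|c u] /=; first by rewrite andbT.
  by rewrite !rcons_path last_rcons => ->.
rewrite !E => Cc; apply: adjacent_connected_minus => l1 l2 ? ?.
by apply: Cc; rewrite E.
Qed.

End NotBlownUp.
End Minimal.

(** * Colouring by a free splitting *)

Section Lengths.
Variable B : finType.
Implicit Types (x : letter B) (u v w : word B).
Notation F := (free_group B).
Implicit Types (g h y z : F) (f : F -> F).

Lemma size_val_mul g h : size (val (g * h)) <= size (val g) + size (val h).
Proof. by rewrite val_mul -size_cat size_red. Qed.

Lemma size_valV g : size (val g^-1) = size (val g).
Proof.
by rewrite -{1}[g]clsK -cls_winv val_cls red_reduced ?size_winv //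
  reducedb_winv (valP g).
Qed.

Lemma gaut_inverse f : is_gaut f ->
  exists2 f', is_gaut f' & cancel f f' /\ cancel f' f.
Proof.
case=> fM fi fs.
pose f' h := proj1_sig (constructive_indefinite_description _ (fs h)).
have f'K : cancel f' f.
  by move=> h; rewrite /f'; case: constructive_indefinite_description.
have fK : cancel f f' by move=> g; apply: fi; rewrite f'K.
exists f' => //; split=> [g h||h]; last by exists (f h).
  by apply: fi; rewrite fM !f'K.
exact: can_inj f'K.
Qed.

Lemma morph_lipschitz f : {morph f : g h / g * h} ->
  exists M, forall g, size (val (f g)) <= M * size (val g).
Proof.
move=> fM; exists (\max_x size (val (f (cls [:: x])))) => g.
rewrite -{1}[g]clsK; elim: (val g) => [|x w IH].
  by rewrite cls_nil morph1.
rewrite cls_cons fM mulnS; apply: leq_trans (size_val_mul _ _) _.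
by apply: leq_add => //; apply: (leq_bigmax x).
Qed.

Lemma mul_letter_val g x : val (g * cls [:: x]) = rcons (val g) x \/
  val g = rcons (val (g * cls [:: x])) (inv_letter x).
Proof.
have [R|R] := boolP (reducedb (rcons (val g) x)).
  by left; rewrite -{1}[g]clsK -cls_cat cats1 val_cls red_reduced.
right; rewrite -[in RHS](clsK g); have := valP g; move: R.
case/lastP: (val g) => // u c R Ru.
have xc : x = inv_letter c.
  move: R Ru; rewrite !reducedbE; case: u => [|d u] /=.
    by rewrite andbT /no_backtrack negbK => /eqP.
  by rewrite rcons_path last_rcons => R' Ru'; move: R'; rewrite Ru' => /negbNE/eqP.
rewrite -cats1 -cls_cat -catA xc inv_letterK val_cls.
rewrite -red_catr red_mulV cats0 red_reduced ?cats1 //.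
by move: Ru; rewrite !reducedbE -cats1 => /cat_sorted2[].
Qed.

End Lengths.

(* A free splitting with trivial edge group colours the vertices of the tree by
   the side of one fixed edge; here the side is read off the first letter. *)
Section Colour.
Variables (B : finType) (P : pred B).
Implicit Types (x : letter B) (u v w : word B).
Notation F := (free_group B).
Implicit Types (g h q y z : F).

Definition colour g : bool := if val g is x :: _ then P x.1 else false.

(** The first letter of a normal form changes only across an edge at [1]. *)
Lemma colour_mul_letter g x :
  g != 1 -> g * cls [:: x] != 1 -> colour (g * cls [:: x]) = colour g.
Proof.
move=> g1 gx1; rewrite /colour; case: (mul_letter_val g x) => E.
  rewrite E; case: (val g) (g1) (clsK g) => //= g1' E'.
  by rewrite -E' cls_nil eqxx in g1'.
rewrite E; case: (val _) (gx1) (clsK (g * cls [:: x])) => //= g1' E'.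
by rewrite -E' cls_nil eqxx in g1'.
Qed.

Lemma colour_mul g w : size w < size (val g) -> colour (g * cls w) = colour g.
Proof.
elim: w g => [|x w IH] g /=; first by rewrite cls_nil mulg1.
rewrite cls_cons mulgA => sz.
have sz' : size w < size (val (g * cls [:: x])).
  move: sz; case: (mul_letter_val g x) => ->; rewrite size_rcons //.
  by move=> /ltnW/ltnW.
rewrite IH //; apply: colour_mul_letter; apply/eqP => E.
  by rewrite E val_cls in sz.
by rewrite E val_cls in sz'.
Qed.

(** The coset of [q] modulo the factor on [R] avoids [1], so the path of [w] meets no edge at
    [1]. *)
Lemma colour_mul_outside (R : pred B) q w : ~~ wover R (val q) -> wover R w ->
  colour (q * cls w) = colour q.
Proof.
elim: w q => [|x w IH] q nR; first by rewrite cls_nil mulg1.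
case/andP=> Rx Rw; rewrite cls_cons mulgA.
have nR' : ~~ wover R (val (q * cls [:: x])).
  apply: contra nR => Rq; rewrite -(mulgK (cls [:: x]) q) -cls_inv_letter.
  by rewrite val_mul val_cls wover_red // wover_cat Rq /wover /= Rx.
rewrite IH //; apply: colour_mul_letter; apply/eqP => E.
  by rewrite E val_cls in nR.
by rewrite E val_cls in nR'.
Qed.

Lemma colour_inside q : (wover P (val q) -> q != 1 -> colour q) /\
  (wover (fun b => ~~ P b) (val q) -> ~~ colour q).
Proof.
rewrite /colour -{2}[q]clsK; case: (val q) => [|x w]; first by rewrite cls_nil eqxx.
by split=> /andP[].
Qed.

(** Cosets of the two factors are vertices of the Bass-Serre tree; each lies on one side of the
    fixed edge, with the element [1] excepted. *)
Lemma colour_coset R q : (forall b, R b = P b) \/ (forall b, R b = ~~ P b) ->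
  exists k, forall w, wover R w -> q * cls w != 1 -> colour (q * cls w) = k.
Proof.
move=> HR; have [Rq|nR] := boolP (wover R (val q)); last first.
  by exists (colour q) => w Rw _; apply: colour_mul_outside Rw.
have RM w : wover R w -> wover R (val (q * cls w)).
  by move=> Rw; rewrite val_mul val_cls wover_red // wover_cat Rq wover_red.
case: HR => HR; [exists true | exists false] => w Rw q1.
  apply: (colour_inside _).1 => //; rewrite /wover -(eq_all (fun x => HR x.1)).
  exact: RM.
apply/negbTE/(colour_inside _).2; rewrite /wover -(eq_all (fun x => HR x.1)).
exact: RM.
Qed.

End Colour.

(** * The colouring pulled back along an automorphism *)

Section Blowup.
Variables (B : finType) (Hs : subgroup_seq B) (alpha : word B -> word B).
Variable P : pred B.
Implicit Types (x : letter B) (u v w : word B).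
Notation F := (free_group B).
Implicit Types (g h q y z : F).
Hypothesis aut : is_aut alpha.
Hypothesis split_labels : forall i, i < size Hs ->
  (forall b, core_label (nth [::] (act alpha Hs) i) b -> P b) \/
  (forall b, core_label (nth [::] (act alpha Hs) i) b -> ~~ P b).

Let f := gaut alpha.
Let col g := colour P (f g).

(** The inverse automorphism is Lipschitz, so a long [g] has an image too long for [h] to lead back
    to [1]. *)
Lemma colour_far m : exists N, forall g h, size (val h) <= m ->
  N <= size (val g) -> colour P (f g * h) = col g /\ f g * h != 1.
Proof.
have [f' [f'M _ _] [fK _]] := gaut_inverse (gaut_is_gaut aut).
have [M HM] := morph_lipschitz f'M.
exists (M * m).+1 => g h hm gN.
have lt : size (val h) < size (val (f g)).
  rewrite ltnNge; apply/negP => le; move: gN; apply/negP; rewrite -leqNgt.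
  rewrite -{1}(fK g); apply: leq_trans (HM _) _.
  by rewrite leq_mul2l (leq_trans le hm) orbT.
split; first by rewrite -[h]clsK colour_mul.
apply/eqP => E; have Eh : h = (f g)^-1 by rewrite -(mulKg (f g) h) E mulg1.
by rewrite Eh size_valV ltnn in lt.
Qed.

Lemma act_elliptic i : i < size Hs ->
  exists z R, ((forall b, R b = P b) \/ (forall b, R b = ~~ P b)) /\
   forall h, gsub (nth [::] Hs i) h -> wover R (val (z^-1 * f h * z)).
Proof.
move=> iH; pose K := gsub (nth [::] (act alpha Hs) i).
have sK : is_subgroup K := gsub_subgroup _.
have mono w z : cyc_reduced w -> K (z * cls w * z^-1) ->
    wover P w || wover (fun b => ~~ P b) w.
  move=> Cw Kw; have lab x : x \in w -> core_label (nth [::] (act alpha Hs) i) x.1.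
    move=> /mem_split [u [v E]]; rewrite E in Cw Kw.
    have D := core_dir_rot Cw Kw; case: x E D {Cw Kw} => b [] E D.
      by exists (val (z * cls u)); apply/core_edgeE; rewrite clsK.
    exists (val (z * cls u * cls [:: (b, false)])); apply/core_edgeE.
    by rewrite clsK; apply: (core_dir_flip sK D).
  by case: (split_labels iH) => H; apply/orP; [left|right];
    apply/allP => x /lab/H.
have KE h : gsub (nth [::] Hs i) h -> K (f h).
  by move=> Kh; rewrite /K /act (nth_map [::]) //; apply/gsub_map => //; exists h.
have [z [H|H]] := elliptic sK (fun b => erefl (~~ P b)) mono.
  by exists z, P; split=> [|h /KE/H]; first by left.
by exists z, (fun b => ~~ P b); split=> [|h /KE/H]; first by right.
Qed.

(** Moved by a fixed element [y], the images of both rays stay in one coset of the factor on [R],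
    which is monochromatic away from [1]; far out the move changes no colour. *)
Lemma colour_rays i g z u v : i < size Hs ->
  gsub (nth [::] Hs i) (z * cls u * z^-1) ->
  gsub (nth [::] Hs i) (z * cls v * z^-1) ->
  exists N, forall m n, N <= size (val (g * cls u ^+ m)) ->
    N <= size (val (g * cls v ^+ n)) ->
    col (g * cls u ^+ m) = col (g * cls v ^+ n).
Proof.
move=> iH Ku Kv; have [fM _ _] : is_gaut f := gaut_is_gaut aut.
have [z' [R [HR H]]] := act_elliptic iH.
have [K1 KM KV] := gsub_subgroup (nth [::] Hs i).
pose y := (f z)^-1 * z'.
have [N HN] := colour_far (size (val y)).
have [k Hk] := colour_coset (f g * y) HR.
suff key w n : gsub (nth [::] Hs i) (z * cls w * z^-1) ->
    N <= size (val (g * cls w ^+ n)) -> col (g * cls w ^+ n) = k.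
  by exists N => m n Nu Nv; rewrite (key u) // (key v).
move=> Kw Nw; have [<- n1] := HN _ y (leqnn _) Nw.
have KX : gsub (nth [::] Hs i) (z * cls w ^+ n * z^-1).
  rewrite -expg_conj; elim: (n) => // m IH; rewrite expgS; exact: KM.
have E : f (g * cls w ^+ n) * y =
    (f g * y) * cls (val (z'^-1 * f (z * cls w ^+ n * z^-1) * z')).
  by rewrite clsK !fM (morphV fM) /y; gnorm.
by rewrite E; apply: Hk; rewrite -?E //; apply: H.
Qed.

Section Contradiction.
Hypotheses (min : minimal_complexity Hs) (nb : ~ visibly_blown_up Hs).
Hypothesis two : forall b : B, exists c, c != b.

Lemma reduced_ray u x w n : reducedb (rcons u x) -> cyc_reduced (x :: w) ->
  reducedb (u ++ wpow (x :: w) n.+1).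
Proof.
move=> Ru /(cyc_reduced_wpow n.+1)/cyc_reducedW; rewrite wpowS.
move: Ru; rewrite !reducedbE; case: u => //= c u.
by rewrite rcons_path => /andP[cu ux] R; rewrite cat_path /= cu ux.
Qed.

Lemma colour_constant : exists N k, forall g, N <= size (val g) -> col g = k.
Proof.
have [fM _ _] : is_gaut f := gaut_is_gaut aut.
(* Beyond length [N], appending one letter does not change the pulled-back colour. *)
have [N HN] := colour_far (\max_x size (val (f (cls [:: x])))).
exists N; suff H n : n <= N -> forall u, reducedb u -> size u = N - n ->
    exists k, forall v, reducedb (u ++ v) -> N <= size (u ++ v) ->
    col (cls (u ++ v)) = k.
  have [//||k Hk] := H N (leqnn N) [::]; first by rewrite subnn.
  by exists k => g gN; rewrite -[g]clsK; apply: Hk => //; apply: (valP g).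
elim: n => [|n IH] nN u Ru su.
  rewrite subn0 in su; exists (col (cls u)); elim/last_ind => [|v x IHv] R _.
    by rewrite cats0.
  have R' : reducedb (u ++ v).
    by move: R; rewrite -rcons_cat !reducedbE -cats1 => /cat_sorted2[].
  have N' : N <= size (u ++ v) by rewrite size_cat su leq_addr.
  rewrite -IHv // -cats1 catA cls_cat /col fM.
  have [] := HN (cls (u ++ v)) (f (cls [:: x])) => //.
    exact: (leq_bigmax x).
  by rewrite val_cls red_reduced.
have {}IH x : reducedb (rcons u x) -> exists k, forall v,
    reducedb (rcons u x ++ v) -> N <= size (rcons u x ++ v) ->
    col (cls (rcons u x ++ v)) = k.
  move=> Rx; apply: IH => //; first exact: ltnW.
  by rewrite size_rcons su -subSn // subSS.
(* [C] marks the letters beyond which the colour is constantly [true]. *)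
pose All x := forall v, reducedb (rcons u x ++ v) ->
  N <= size (rcons u x ++ v) -> col (cls (rcons u x ++ v)).
pose C x : bool := excluded_middle_informative (All x).
have CP x : reflect (All x) (C x).
  by rewrite /C; case: excluded_middle_informative => H; constructor.
have Cc x (y : letter B) : reducedb (rcons u x) -> reducedb (rcons u y) ->
    adjacent Hs x y -> C x -> C y.
  (* Adjacent letters begin loops at one core vertex; the rays of these loops from [u] agree far out
     and transport the colour from [x] to [y]. *)
  move=> Rx Ry [i [z [iH [wx [Cx Kx]] [wy [Cy Ky]]]]] /CP Ax.
  have [N' HN'] := colour_rays (cls u) iH Kx Ky.
  (* Large enough both for constancy beyond a letter and for the comparison of rays. *)
  pose m := (N + N')%N.
  have long x' w' : reducedb (rcons u x') -> cyc_reduced (x' :: w') ->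
    exists v, [/\ reducedb (rcons u x' ++ v),
      rcons u x' ++ v = u ++ wpow (x' :: w') m.+1 & m <= size (rcons u x' ++ v)].
    move=> R' C'; exists (w' ++ wpow (x' :: w') m).
    have E : rcons u x' ++ w' ++ wpow (x' :: w') m = u ++ wpow (x' :: w') m.+1.
      by rewrite cat_rcons.
    rewrite E; split=> //; first exact: reduced_ray.
    rewrite size_cat; apply: leq_trans (leq_addl _ _).
    exact: leq_trans (leqnSn m) (size_wpow _ _).
  have [vx [Rvx Ex sx]] := long x wx Rx Cx.
  have [vy [Rvy Ey sy]] := long y wy Ry Cy.
  have [k Hk] := IH y Ry; apply/CP => v Rv sv; rewrite (Hk v Rv sv).
  rewrite -(Hk vy Rvy); last exact: leq_trans (leq_addr _ _) sy.
  have := Ax vx Rvx (leq_trans (leq_addr _ _) sx).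
  have Fx : cls (rcons u x ++ vx) = cls u * cls (x :: wx) ^+ m.+1.
    by rewrite Ex cls_cat cls_wpow.
  have Fy : cls (rcons u y ++ vy) = cls u * cls (y :: wy) ^+ m.+1.
    by rewrite Ey cls_cat cls_wpow.
  rewrite Fx Fy (HN' m.+1 m.+1) // -?Fx -?Fy val_cls red_reduced //.
    exact: leq_trans (leq_addl _ _) sx.
  exact: leq_trans (leq_addl _ _) sy.
have ext v : reducedb (u ++ v) -> N <= size (u ++ v) ->
    exists x v', [/\ u ++ v = rcons u x ++ v' & reducedb (rcons u x)].
  case: v => [|x v] R sz.
    by rewrite cats0 su leqNgt ltn_subrL (leq_trans _ nN) in sz.
  exists x, v; rewrite cat_rcons; split=> //.
  by move: R; rewrite -cat_rcons !reducedbE => /cat_sorted2[].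
have [[x [Rx Cx]]|nC] := excluded_middle_informative
    (exists x, reducedb (rcons u x) /\ C x).
  exists true => v R sz; have [y [v' [E Ry]]] := ext v R sz.
  rewrite E in R sz *.
  exact: (CP _ (adjacent_connected_after min nb two Ru Cc Rx Ry Cx)) _ R sz.
(* The colour beyond each letter is constant, and no letter has the constant [true]. *)
exists false => v R sz; have [y [v' [E Ry]]] := ext v R sz.
rewrite E in R sz *; have [k Hk] := IH y Ry; rewrite Hk //.
case: k Hk => // Hk; case: nC; exists y; split=> //.
by apply/CP => v'' R' sz'; rewrite Hk.
Qed.

Lemma colour_not_constant b1 b2 : P b1 -> ~~ P b2 -> False.
Proof.
move=> P1 P2; have [N [k Hk]] := colour_constant.
have [fM _ fs] : is_gaut f := gaut_is_gaut aut.
have [M HM] := morph_lipschitz fM.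
have ex b : exists2 g, N <= size (val g) & col g = P b.
  (* An element shorter than [N] has an image of length at most [M * N], so the preimage of this
     power is long. *)
  pose w : word B := nseq (M * N).+1 (b, true).
  have Rw : reducedb w.
    rewrite reducedbE /w /=; elim: (M * N)%N => //= m ->.
    by rewrite /no_backtrack /inverse_pair /inv_letter /= xpair_eqE andbF.
  have [g Eg] := fs (cls w); exists g; last first.
    by rewrite /col Eg /colour val_cls red_reduced.
  rewrite leqNgt; apply/negP => lt; have := HM g.
  rewrite Eg val_cls red_reduced // size_nseq ltnNge leq_mul2l.
  by rewrite (ltnW lt) orbT.
have [g1 s1 E1] := ex b1; have [g2 s2 E2] := ex b2.
by move: P1 P2; rewrite -E1 -E2 !Hk // => ->.
Qed.

End Contradiction.
End Blowup.

Lemma minimal_visibly_blown_up (B : finType) (Hs : subgroup_seq B) alpha :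
  is_aut alpha -> minimal_complexity Hs -> visibly_blown_up (act alpha Hs) ->
  visibly_blown_up Hs.
Proof.
move=> aut min [P [[b1 P1] [[b2 P2] HP]]]; apply: NNPP => nb.
have n12 : b1 != b2 by apply: contraNneq P2 => <-.
apply: (colour_not_constant aut (P := P)) min nb _ _ _ P1 P2 => [i iH|b].
  by apply: HP; rewrite size_map.
by have [<-|] := eqVneq b1 b; [exists b2; rewrite eq_sym | exists b1].
Qed.

(** * Conjugacy and Gersten representatives *)

Section Conjugation.
Variable B : finType.
Notation F := (free_group B).
Implicit Types (g h z : F) (H : seq (word B)) (Hs : subgroup_seq B).

Lemma same_classE H1 H2 : same_class H1 H2 <->
  exists g, forall h, gsub H1 h <-> gsub H2 (g * h * g^-1).
Proof.
split=> [[u Hu]|[g Hg]].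
  exists (cls u) => h; rewrite -[h]clsK -in_subE Hu in_subE.
  by rewrite !cls_cat cls_winv mulgA.
exists (val g) => w; rewrite !in_subE Hg !cls_cat cls_winv clsK mulgA.
by [].
Qed.

Lemma same_class_sym H1 H2 : same_class H1 H2 -> same_class H2 H1.
Proof.
move=> /same_classE[g Hg]; apply/same_classE; exists g^-1 => h.
by rewrite Hg; gnorm.
Qed.

Lemma same_class_trans H1 H2 H3 :
  same_class H1 H2 -> same_class H2 H3 -> same_class H1 H3.
Proof.
move=> /same_classE[g Hg] /same_classE[g' Hg']; apply/same_classE.
by exists (g' * g) => h; rewrite Hg Hg'; gnorm.
Qed.

Lemma core_dir_conj H1 H2 g h l :
  (forall h, gsub H1 h <-> gsub H2 (g * h * g^-1)) ->
  core_dir (gsub H1) h l -> core_dir (gsub H2) (g * h) l.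
Proof.
move=> E [w [C /E Kw]]; exists w; split=> //.
by move: Kw; congr (gsub H2); gnorm.
Qed.

Lemma core_label_conj H1 H2 b :
  same_class H1 H2 -> core_label H1 b -> core_label H2 b.
Proof.
move=> /same_classE[g E] [x /core_edgeE /(core_dir_conj E) D].
by exists (val (g * cls x)); apply/core_edgeE; rewrite clsK.
Qed.

(** Left translation by the conjugating element identifies the two core graphs. *)
Lemma core_nedges_conj H1 H2 n :
  same_class H1 H2 -> core_nedges H1 n -> core_nedges H2 n.
Proof.
move=> sc; have /same_classE[g' E'] := same_class_sym sc.
move: sc => /same_classE[g E] [s [<- [sQ [sP sE]]]].
pose t (e : word B * B) : word B * B := (val (g * cls e.1), e.2).
have tE e e' : same_edge H2 (t e) (t e') <-> same_edge H1 e e'.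
  rewrite /same_edge !same_cosetE /= !clsK E.
  by have -> : g * cls e.1 * (g * cls e'.1)^-1 = g * (cls e.1 * (cls e'.1)^-1) * g^-1
    by gnorm.
exists (map t s); split; first by rewrite size_map.
split; [|split].
- move=> _ /mapP[e /sQ /core_edgeE D ->]; apply/core_edgeE; rewrite clsK.
  exact: core_dir_conj E D.
- elim: s sP {sQ sE} => //= e s IH [He /IH Hs]; split=> // _ /mapP[e' /He nE ->].
  by rewrite tE.
- move=> x b /core_edgeE D.
  have D' : core_dir (gsub H1) (g^-1 * cls x) (b, true).
    case: D => w [C Kw]; exists w; split=> //; apply/E.
    by move: Kw; congr (gsub H2); gnorm.
  have [|e [es Ee]] := sE (val (g^-1 * cls x)) b.
    by apply/core_edgeE; rewrite clsK.
  exists (t e); split; first exact: map_f.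
  move/tE: Ee => [/= Eb /same_cosetE Ke]; split=> //; apply/same_cosetE.
  by move: Ke; rewrite /= !clsK; congr (gsub H2); gnorm.
Qed.

Lemma same_class_seq_sym Hs1 Hs2 : same_class_seq Hs1 Hs2 -> same_class_seq Hs2 Hs1.
Proof. by case=> sz E; split=> // i; rewrite -sz => /E/same_class_sym. Qed.

Lemma same_class_seq_trans Hs1 Hs2 Hs3 :
  same_class_seq Hs1 Hs2 -> same_class_seq Hs2 Hs3 -> same_class_seq Hs1 Hs3.
Proof.
move=> [sz E] [sz' E']; split=> [|i iH]; first by rewrite sz.
by apply: same_class_trans (E i iH) (E' i _); rewrite -sz.
Qed.

Lemma visibly_blown_up_conj Hs1 Hs2 :
  same_class_seq Hs1 Hs2 -> visibly_blown_up Hs1 -> visibly_blown_up Hs2.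
Proof.
move=> sc [P [P1 [P2 HP]]]; exists P; split=> //; split=> // i.
move: sc => /same_class_seq_sym[sz E] iH.
have lab b := @core_label_conj _ _ b (E i iH).
by case: (HP i); rewrite -?sz // => H; [left|right] => b /lab/H.
Qed.

Lemma complexity_conj Hs1 Hs2 n :
  same_class_seq Hs1 Hs2 -> complexity Hs1 n -> complexity Hs2 n.
Proof.
move=> [sz E] [ns [szn [Hn <-]]]; exists ns; split; first by rewrite -sz.
split=> // i; rewrite -sz => iH; exact: core_nedges_conj (E i iH) (Hn i iH).
Qed.

Lemma same_class_map alpha H1 H2 : is_aut alpha ->
  same_class H1 H2 -> same_class (map alpha H1) (map alpha H2).
Proof.
move=> aut /same_classE[g E]; apply/same_classE; exists (gaut alpha g) => h.
have [fM fi fs] := gaut_is_gaut aut; rewrite !gsub_map //.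
have [h' <-] := fs h; rewrite -(morphV fM) -!fM !image_subE //; exact: E.
Qed.

Lemma same_class_seq_act alpha Hs1 Hs2 : is_aut alpha ->
  same_class_seq Hs1 Hs2 -> same_class_seq (act alpha Hs1) (act alpha Hs2).
Proof.
move=> aut [sz E]; split; first by rewrite !size_map.
move=> i; rewrite size_map => iH; rewrite /act !(nth_map [::]) -?sz //.
exact: same_class_map (E i iH).
Qed.

Lemma act_comp (alpha beta : word B -> word B) Hs :
  act alpha (act beta Hs) = act (alpha \o beta) Hs.
Proof. by rewrite /act -map_comp; apply: eq_map => H /=; rewrite -map_comp. Qed.

Lemma is_aut_comp (alpha beta : word B -> word B) :
  is_aut alpha -> is_aut beta -> is_aut (alpha \o beta).
Proof.
move=> [a1 [a2 [a3 a4]]] [c1 [c2 [c3 c4]]]; split; [|split; [|split]] => /=.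
- by move=> u v /c1/a1.
- by move=> u v; rewrite /eqF (a1 _ _ (c2 u v)) a2.
- by move=> u v /a3/c3.
- move=> v; have [u Hu] := a4 v; have [t Ht] := c4 u; exists t.
  by rewrite /eqF (a1 _ _ Ht).
Qed.

Lemma is_aut_id : is_aut (@id (word B)).
Proof. by do 3?split=> //; move=> v; exists v. Qed.

Lemma act_ext alpha beta Hs : is_aut alpha -> is_aut beta ->
  (forall w, eqF (alpha w) (beta w)) -> same_class_seq (act alpha Hs) (act beta Hs).
Proof.
move=> aa ab E; split; first by rewrite !size_map.
move=> i; rewrite size_map => iH; rewrite /act !(nth_map [::]) //.
apply/same_classE; exists 1 => h; rewrite mul1g invg1 mulg1 !gsub_map //.
have gE g : gaut alpha g = gaut beta g by apply/eqF_cls/E.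
by split=> -[g Kg ->]; exists g.
Qed.

Lemma aut_inverse (alpha : word B -> word B) : is_aut alpha ->
  exists2 beta, is_aut beta & forall w, eqF (beta (alpha w)) w.
Proof.
move=> aut; have [f' gf' [fK _]] := gaut_inverse (gaut_is_gaut aut).
exists (waut f') => [|w]; first exact: waut_is_aut.
by apply/eqF_cls; rewrite clsK gautE // fK.
Qed.

(** Up to conjugacy the orbit of [Hs'] lies in that of [Hs], so minimality passes over. *)
Lemma gersten_rep_minimal Hs Hs' : gersten_rep Hs' Hs -> minimal_complexity Hs'.
Proof.
case=> [[beta [ab sc]] [n [Cn min]]]; exists n; split=> // alpha m aa Cm.
apply: (min (alpha \o beta) m); first exact: is_aut_comp.
rewrite -act_comp; apply: complexity_conj Cm; exact: same_class_seq_act.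
Qed.

Lemma gersten_rep_exists Hs : exists Hs', gersten_rep Hs' Hs.
Proof.
pose Q n := exists2 alpha, is_aut alpha & complexity (act alpha Hs) n.
have [n0 Q0] : exists n, Q n.
  have [n Cn] := complexity_exists (act id Hs); exists n, id => //.
  exact: is_aut_id.
have [n [alpha aa Cn] minn] : exists2 n, Q n & forall m, Q m -> n <= m.
  elim/ltn_ind: n0 Q0 => n IH Qn.
  have [[m [mn Qm]]|nm] := excluded_middle_informative (exists m, m < n /\ Q m).
    exact: IH mn Qm.
  exists n => // m Qm; rewrite leqNgt; apply/negP => mn; apply: nm.
  by exists m.
exists (act alpha Hs); split.
  by exists alpha; split=> //; apply: act_ext.
by exists n; split=> // beta m ab Cm; apply: minn; exists beta.
Qed.

(** With [gamma] inverse to [beta], applying [alpha \o gamma] to [Hs'] gives [act alpha Hs] up to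
    conjugacy, and minimality of [Hs'] brings the blow-up back. *)
Lemma gersten_rep_blown_up alpha Hs Hs' : is_aut alpha ->
  visibly_blown_up (act alpha Hs) -> gersten_rep Hs' Hs -> visibly_blown_up Hs'.
Proof.
move=> aa vb gr; have min := gersten_rep_minimal gr.
case: gr => [[beta [ab sc]] _]; have [gamma ag E] := aut_inverse ab.
have aag := is_aut_comp aa ag.
apply: (minimal_visibly_blown_up aag min).
apply: visibly_blown_up_conj vb; apply: same_class_seq_sym.
apply: same_class_seq_trans (same_class_seq_act aag sc) _.
rewrite act_comp; apply: act_ext => //; first exact: is_aut_comp.
by move=> w /=; case: aa => + _; apply; apply: E.
Qed.

End Conjugation.

(** * The cycle of implications between the three conditions *)

Theorem lemma9p14 (B : finType) (Hs : subgroup_seq B) :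
  [/\ ((exists alpha, is_aut alpha /\ visibly_blown_up (act alpha Hs)) <->
       (exists Hs', gersten_rep Hs' Hs /\ visibly_blown_up Hs')),
      ((exists Hs', gersten_rep Hs' Hs /\ visibly_blown_up Hs') <->
       (forall Hs', gersten_rep Hs' Hs -> visibly_blown_up Hs')) &
      ((exists alpha, is_aut alpha /\ visibly_blown_up (act alpha Hs)) <->
       (forall Hs', gersten_rep Hs' Hs -> visibly_blown_up Hs'))].
Proof.
have i12 : (exists alpha, is_aut alpha /\ visibly_blown_up (act alpha Hs)) ->
    forall Hs', gersten_rep Hs' Hs -> visibly_blown_up Hs'.
  by move=> [alpha [aa vb]] Hs'; apply: gersten_rep_blown_up vb.
have i23 : (forall Hs', gersten_rep Hs' Hs -> visibly_blown_up Hs') ->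
    exists Hs', gersten_rep Hs' Hs /\ visibly_blown_up Hs'.
  by move=> H; have [Hs' gr] := gersten_rep_exists Hs; exists Hs'; split; last exact: H.
have i31 : (exists Hs', gersten_rep Hs' Hs /\ visibly_blown_up Hs') ->
    exists alpha, is_aut alpha /\ visibly_blown_up (act alpha Hs).
  move=> [Hs' [[[beta [ab sc]] _] vb]]; exists beta; split=> //.
  exact: visibly_blown_up_conj vb.
by split; split=> H; auto.
Qed.
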